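(* Let $s:\Theta\to[0,1]$ be nondecreasing. Then $s$ is feasible (i.e., there exists an allocation $\chi$ inducing it) if and only if $$\int_x^{\bar\theta} s(\theta)\,dF(\theta)\;\le\;\int_x^{\bar\theta} F(\theta)\,dF(\theta)\qquad\text{for all }x\in[0,\bar\theta].$$
   Context: Let $0<\bar\theta<\infty$, $\Theta=[0,\bar\theta]$, and let $F$ be a cumulative distribution function on $\Theta$ with a continuous, strictly positive density $f$; $dF(\theta)=f(\theta)\,d\theta$. A continuum (unit mass) of buyers has types distributed according to $F$. The set of positional-good levels is $X=(0,\infty)$, and $\tilde X=X\cup\{0\}$, where $0$ denotes not buying (exclusion). Let $\Omega=[0,1]$ carry the uniform probability measure. An allocation is a measurable map $\chi:\Theta\times\Omega\to\tilde X$. For each $\omega$, let $G_\chi(q\mid\omega)=\int \mathbf 1[\chi(\theta,\omega)\le q]\,dF(\theta)$ for $q\in\tilde X$, and $G^-_\chi(q\mid\omega)=\lim_{q'\uparrow q}G_\chi(q'\mid\omega)$ (the mass of buyers with strictly lower level, including those with level $0$). The status of a buyer at level $q$ under distribution $G$ is $S(q,G)=\frac{G^-(q)+G(q)}{2}$ if $q\in X$, and $S(0,G)=0$. The interim status induced by $\chi$ is $s(\theta)=\mathbb E_\omega\big[S(\chi(\theta,\omega),G_\chi(\cdot\mid\omega))\big]$. A function $s:\Theta\to[0,1]$ is called feasible if it is the interim status induced by some allocation $\chi$. *)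

(* Defs.v *)
From HB Require Import structures.
From mathcomp Require Import all_boot all_order all_algebra.
From mathcomp Require Import all_classical all_reals all_analysis.
Set Implicit Arguments. Unset Strict Implicit. Unset Printing Implicit Defensive.
Import Order.TTheory GRing.Theory Num.Theory.
Import numFieldNormedType.Exports.
Local Open Scope classical_set_scope.
Local Open Scope ring_scope.

Section Positional.
Variable R : realType.
Local Notation mu := (@lebesgue_measure R).

Definition cdfF (f : R -> R) (th : R) : R :=
  fine (\int[mu]_(t in `[0%R, th]) (f t)%:E)%E.

(* An allocation: chi theta omega is the level of type theta in state omega;
   0 means exclusion, positive reals are positional-good levels. Jointly
   measurable on Theta x Omega, values in X~ = [0, oo). *)
Definition allocation (thb : R) (chi : R -> R -> R) : Prop :=
  measurable_fun (`[0, thb] `*` `[0, 1] : set (R * R)) (fun p : R * R => chi p.1 p.2) /\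
  (forall th om, th \in `[0, thb] -> om \in `[0, 1] -> 0 <= chi th om).

Definition Gchi (thb : R) (f : R -> R) (chi : R -> R -> R) (om q : R) : R :=
  fine (\int[mu]_(t in `[0%R, thb]) ((if chi t om <= q then f t else 0)%R)%:E)%E.

(* G^-_chi(q | omega) = lim_{q' -> q-} G_chi(q' | omega)
   (left limit; it equals the mass of types with level strictly below q) *)
Definition Gchim (thb : R) (f : R -> R) (chi : R -> R -> R) (om q : R) : R :=
  lim (Gchi thb f chi om q' @[q' --> q^'-]).

Definition status (Gm G : R -> R) (q : R) : R :=
  if 0 < q then (Gm q + G q) / 2 else 0.

(* interim status s(theta) = E_omega[ S(chi(theta,omega), G_chi(.|omega)) ],
   omega uniform on [0,1] *)
Definition interim (thb : R) (f : R -> R) (chi : R -> R -> R) (th : R) : R :=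
  fine (\int[mu]_(om in `[0%R, 1%R])
          (status (Gchim thb f chi om) (Gchi thb f chi om) (chi th om))%:E)%E.

Definition feasible (thb : R) (f : R -> R) (s : R -> R) : Prop :=
  exists chi : R -> R -> R, allocation thb chi /\
    forall th, th \in `[0, thb] -> s th = interim thb f chi th.

End Positional.

(* Main.v *)
(** Necessity: in each state the status of [th] is at most the [F]-average over
[th'] of [win (chi th) (chi th')], and [win q r + win r q = 1]; hence a set of
types of mass [m] has total status at most [m^2/2 + m (1 - m)], with equality
for the top types ranked efficiently.

Sufficiency: put [K x = 1/2 - \int_x^thb s dF], a function with
[F]-subgradient [s], so that the majorization condition reads [K >= F^2/2].  In
state [t \in [0, 1]] a type gets as level the slope at this type of the
largest minorant of [K - (1 - t) F^2/2] that is a nondecreasing convex function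
of [F].  The types of equal slope form an interval pooled at the average of its
endpoints, slope 0 being exclusion.  The derivative of the minorant in [t] is
the interpolation of [F^2/2] at the endpoints of the pools, whose [F]-slope is
precisely the status in state [t].  The minorant is 0 at [t = 0] and [K] at
[t = 1], so the interim status is another [F]-subgradient of [K] and equals [s]
off a countable set.  The types of this null set are given a lottery between
exclusion and a level above all others. *)

Require Import Defs.
From HB Require Import structures.
From mathcomp Require Import all_boot all_order all_algebra.
From mathcomp Require Import all_classical all_reals all_analysis.
From mathcomp Require Import measurable_realfun ring lra.
Import Order.TTheory GRing.Theory Num.Theory.
Import numFieldNormedType.Exports.
Local Open Scope classical_set_scope.
Local Open Scope ring_scope.

(** * Integrals of monotone subgradients *)

Section Integration.
Variable R : realType.
Local Notation mu := (@lebesgue_measure R).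

(** On [n] equal pieces of [[a, b]] the bounds add up, with [phi] telescoping, to
    [(phi b - phi a) * M * (b - a) / n], which is arbitrarily small. *)
Lemma small_increments_const (D phi : R -> R) (a b M : R) : a <= b ->
  (forall x y, x \in `[a, b] -> y \in `[a, b] -> x <= y ->
     `|D y - D x| <= (phi y - phi x) * (M * (y - x))) -> D b = D a.
Proof.
move=> ab H; apply/eqP; rewrite -subr_eq0 -normr_le0.
pose C := (phi b - phi a) * (M * (b - a)).
suff HN n : (0 < n)%N -> n%:R * `|D b - D a| <= C.
  rewrite leNgt; apply/negP => d0.
  have := HN (Num.truncn (C / `|D b - D a|)).+1 isT.
  rewrite -ler_pdivlMr// leNgt => /negP; apply.
  exact: truncnS_gt.
move=> n0; have nR : (0 : R) < n%:R by rewrite ltr0n.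
pose x i : R := a + i%:R * ((b - a) / n%:R).
have h0 : 0 <= (b - a) / n%:R by rewrite divr_ge0// subr_ge0.
have x0 : x 0%N = a by rewrite /x mul0r addr0.
have xn : x n = b by rewrite /x mulrC divfK ?gt_eqF//; lra.
have xmono i : x i <= x i.+1.
  by rewrite /x -natr1; lra.
have xI i : (i <= n)%N -> x i \in `[a, b].
  move=> iN; rewrite in_itv/=; apply/andP; split.
    by rewrite /x lerDl mulr_ge0.
  by rewrite -xn /x lerD2l ler_wpM2r// ler_nat.
have ind i : (i <= n)%N ->
    `|D (x i) - D a| <= (phi (x i) - phi a) * (M * ((b - a) / n%:R)).
  elim: i => [_|i IH iN]; first by rewrite x0 !subrr normr0 mul0r.
  have := H _ _ (xI i (ltnW iN)) (xI _ iN) (xmono i).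
  have -> : x i.+1 - x i = (b - a) / n%:R by rewrite /x -natr1; ring.
  have := IH (ltnW iN).
  have := ler_normD (D (x i.+1) - D (x i)) (D (x i) - D a).
  rewrite (_ : D (x i.+1) - D (x i) + (D (x i) - D a) = D (x i.+1) - D a); last ring.
  lra.
have := ind n (leqnn n); rewrite xn => {}ind.
rewrite mulrC -ler_pdivlMr//.
suff -> : C / n%:R = (phi b - phi a) * (M * ((b - a) / n%:R)) by [].
by rewrite /C; field; rewrite gt_eqF.
Qed.

Lemma bounded_itv_integrable (a b M : R) (g : R -> R) :
  measurable_fun `[a, b] g -> (forall x, x \in `[a, b] -> `|g x| <= M) ->
  mu.-integrable `[a, b] (EFin \o g).
Proof.
move=> mg gM; apply: measurable_bounded_integrable => //.
  by rewrite /= lebesgue_measure_itv/=; case: ifP => _; rewrite -?EFinD ltry.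
exists M; split; first exact: num_real.
by move=> N MN x /= xab; rewrite (le_trans (gM x xab))// ltW.
Qed.

(** Precomposing [phi] with the projection of the line onto [[a, b]] gives a globally monotone
    function. *)
Lemma mono_on_measurable (a b : R) (phi : R -> R) :
  (forall x y, x \in `[a, b] -> y \in `[a, b] -> x <= y -> phi x <= phi y) ->
  measurable_fun `[a, b] phi.
Proof.
move=> mono; have [ab|ba] := leP a b; last first.
  by rewrite set_itv_ge ?bnd_simp -?ltNge//; exact: measurable_fun_set0.
pose c x := Num.max a (Num.min b x).
have cI x : c x \in `[a, b].
  by rewrite in_itv/= /c le_max lexx/= ge_max ab/= ge_min lexx.
have cM x y : x <= y -> c x <= c y.
  move=> xy; rewrite /c ge_max !le_max lexx/=; apply/orP; right.
  by rewrite le_min !ge_min lexx xy orbT.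
apply: (eq_measurable_fun (phi \o c)).
  move=> x; rewrite inE/= in_itv/= => /andP[ax xb].
  by rewrite /c /= (min_r xb) (max_r ax).
by apply: nondecreasing_measurable => // x y xy /=; apply: mono => //; exact: cM.
Qed.

Lemma integral_split (a b x y : R) (g : R -> R) :
  mu.-integrable `[a, b] (EFin \o g) -> a <= x -> x <= y -> y <= b ->
  \int[mu]_(t in `[a, y]) g t - \int[mu]_(t in `[a, x]) g t =
  \int[mu]_(t in `[x, y]) g t.
Proof.
move=> ig ax xy yb.
have iy : mu.-integrable `[a, y] (EFin \o g).
  by apply: integrableS ig => //; apply: subset_itvl; rewrite bnd_simp.
rewrite Rintegral_itvB ?bnd_simp// Rintegral_itv_obnd_cbnd//.
by apply: integrableS iy => //; apply: subset_itvr; rewrite bnd_simp.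
Qed.

Lemma mono_weight_integrable (a b M : R) (phi w : R -> R) : a <= b ->
  (forall x y, x \in `[a, b] -> y \in `[a, b] -> x <= y -> phi x <= phi y) ->
  measurable_fun `[a, b] w -> (forall u, u \in `[a, b] -> 0 <= w u <= M) ->
  mu.-integrable `[a, b] (EFin \o (fun t => phi t * w t)).
Proof.
move=> ab mono mw wM.
have aI : a \in `[a, b] by rewrite in_itv/= lexx.
have bI : b \in `[a, b] by rewrite in_itv/= lexx ab.
apply: (bounded_itv_integrable _ _ (Num.max `|phi a| `|phi b| * M)).
  by apply: measurable_funM => //; exact: mono_on_measurable.
move=> u uI; rewrite normrM; have /andP[w0 wM'] := wM _ uI.
have := uI; rewrite in_itv/= => /andP[xu uy].
rewrite ler_pM//; last by rewrite ger0_norm.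
have h1 := mono _ _ aI uI xu; have h2 := mono _ _ uI bI uy.
rewrite le_max; case: (ger0P (phi u)) => p0.
  by rewrite orbC ger0_norm ?h2// (le_trans p0).
by rewrite (ltr0_norm (le_lt_trans h1 p0)) lerN2 h1.
Qed.

Lemma mono_weight_bounds (x y M : R) (phi w : R -> R) : x <= y ->
  (forall u v, u \in `[x, y] -> v \in `[x, y] -> u <= v -> phi u <= phi v) ->
  measurable_fun `[x, y] w -> (forall u, u \in `[x, y] -> 0 <= w u <= M) ->
  phi x * \int[mu]_(t in `[x, y]) w t <= \int[mu]_(t in `[x, y]) (phi t * w t)
    <= phi y * \int[mu]_(t in `[x, y]) w t.
Proof.
move=> xy mono mw wM.
have xI : x \in `[x, y] by rewrite in_itv/= lexx.
have yI : y \in `[x, y] by rewrite in_itv/= lexx xy.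
have iw : mu.-integrable `[x, y] (EFin \o w).
  apply: (bounded_itv_integrable _ _ M) => // u /wM/andP[w0 wM'].
  by rewrite ger0_norm.
have ipw : mu.-integrable `[x, y] (EFin \o (fun t => phi t * w t)).
  exact: (mono_weight_integrable _ _ M).
have ic c : mu.-integrable `[x, y] (EFin \o (fun t => c * w t)).
  apply: eq_integrable (integrableZl _ c iw) => //.
rewrite -!RintegralZl//; apply/andP; split; apply: le_Rintegral => // u /= uI;
  have /andP[w0 _] := wM _ uI; apply: ler_wpM2r => //; apply: mono => //;
  by move: uI; rewrite in_itv/= => /andP[].
Qed.

(** A fundamental theorem of calculus for monotone subgradients: the increments over [[x, y]] of [h]
    and of the integral lie between the same two bounds, whose gap is at most
    [(phi y - phi x) * M * (y - x)]; so [small_increments_const] applies to the difference. *)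
Lemma subgrad_integral (a b M : R) (phi w h : R -> R) : a <= b ->
  (forall x y, x \in `[a, b] -> y \in `[a, b] -> x <= y -> phi x <= phi y) ->
  measurable_fun `[a, b] w -> (forall u, u \in `[a, b] -> 0 <= w u <= M) ->
  (forall x y, x \in `[a, b] -> y \in `[a, b] -> x <= y ->
     phi x * \int[mu]_(t in `[x, y]) w t <= h y - h x
       <= phi y * \int[mu]_(t in `[x, y]) w t) ->
  \int[mu]_(t in `[a, b]) (phi t * w t) = h b - h a.
Proof.
move=> ab mono mw wM hb.
have aI : a \in `[a, b] by rewrite in_itv/= lexx.
have bI : b \in `[a, b] by rewrite in_itv/= lexx ab.
pose I x := \int[mu]_(t in `[a, x]) (phi t * w t).
have ipw : mu.-integrable `[a, b] (EFin \o (fun t => phi t * w t)).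
  exact: (mono_weight_integrable _ _ M).
have Ia : I a = 0 by rewrite /I set_itv1 Rintegral_set1.
suff : h b - I b = h a - I a by rewrite Ia /I; lra.
apply: (small_increments_const (fun x => h x - I x) phi a b M) => // x y xI yI xy.
have := xI; have := yI; rewrite !in_itv/= => /andP[ay yb] /andP[ax xb].
have sub : `[x, y] `<=` `[a, b] by apply: subset_itv; rewrite bnd_simp.
have := hb _ _ xI yI xy => /andP[h1 h2].
have /andP[h3 h4] : phi x * \int[mu]_(t in `[x, y]) w t <=
   \int[mu]_(t in `[x, y]) (phi t * w t) <= phi y * \int[mu]_(t in `[x, y]) w t.
  apply: (mono_weight_bounds _ _ M) => //.
  - by move=> u v /sub uI /sub vI; exact: mono.
  - exact: measurable_funS mw.
  - by move=> u /sub; exact: wM.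
have IE : I y - I x = \int[mu]_(t in `[x, y]) (phi t * w t).
  by rewrite (integral_split a b).
have wI : \int[mu]_(t in `[x, y]) w t <= M * (y - x).
  rewrite (_ : M * (y - x) = \int[mu]_(t in `[x, y]) M).
    apply: le_Rintegral => //.
    - apply: (bounded_itv_integrable _ _ M); first exact: measurable_funS mw.
      by move=> u /sub /wM/andP[? ?]; rewrite ger0_norm.
    - by apply: (bounded_itv_integrable _ _ `|M|).
    - by move=> u /sub /wM/andP[].
  rewrite Rintegral_cst//= lebesgue_measure_itv/= lte_fin.
  by move: xy; rewrite le_eqVlt => /predU1P[->|xy]; rewrite ?ltxx ?subrr ?xy.
rewrite (_ : h y - I y - (h x - I x) = (h y - h x) - (I y - I x)); last ring.
rewrite IE ler_norml; have := mono _ _ xI yI xy.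
move: h1 h2 h3 h4 wI; clear.
set u := \int[mu]_(t in _) w t; set v := \int[mu]_(t in _) _.
move=> h1 h2 h3 h4 uM pp.
have : (phi y - phi x) * u <= (phi y - phi x) * (M * (y - x)).
  by rewrite ler_wpM2l// subr_ge0.
by move=> h5; apply/andP; split; lra.
Qed.

End Integration.

(** * Status as an average over pairs of types *)

Section Allocation.
Variables (R : realType) (thb : R) (f : R -> R).
Local Notation mu := (@lebesgue_measure R).
Hypothesis f_meas : measurable_fun `[0, thb] f.
Hypothesis f_ge0 : forall t, t \in `[0, thb] -> 0 <= f t.
Hypothesis f_mass : (\int[mu]_(t in `[0%R, thb]) (f t)%:E = 1)%E.

Lemma f_integrable : mu.-integrable `[0, thb] (EFin \o f).
Proof.
apply/integrableP; split; first exact/measurable_EFinP.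
rewrite (_ : integral _ _ _ = 1%E) ?ltry// -f_mass; apply: eq_integral => t.
by rewrite inE => tT /=; rewrite ger0_norm// f_ge0.
Qed.

Lemma measurable_if_lt (c : R -> R) (q : R) : measurable_fun `[0, thb] c ->
  measurable_fun `[0, thb] (fun t => if c t < q then f t else 0).
Proof.
move=> mc; apply: measurable_fun_if => //; first exact: measurable_fun_ltr.
by apply: measurable_funS f_meas => // x [].
Qed.

Lemma measurable_if_le (c : R -> R) (q : R) : measurable_fun `[0, thb] c ->
  measurable_fun `[0, thb] (fun t => if c t <= q then f t else 0).
Proof.
move=> mc; apply: measurable_fun_if => //; first exact: measurable_fun_ler.
by apply: measurable_funS f_meas => // x [].
Qed.

Lemma integrable_if (b : R -> bool) :
  measurable_fun `[0, thb] (fun t => if b t then f t else 0) ->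
  mu.-integrable `[0, thb] (fun t => (if b t then f t else 0)%:E).
Proof.
move=> mb; apply: le_integrable f_integrable => //; first exact/measurable_EFinP.
by move=> t /= tT; case: ifP => _; rewrite lee_fin ?normr0.
Qed.

(** Along a sequence tending to [q] from strictly below, the indicator of [c t <= q'] tends
    pointwise to that of [c t < q], and [f] dominates. *)
Lemma left_limit_mass (c : R -> R) (q : R) : measurable_fun `[0, thb] c ->
  lim (fine (\int[mu]_(t in `[0%R, thb]) (if c t <= q' then f t else 0)%:E)
    @[q' --> q^'-]) =
  fine (\int[mu]_(t in `[0%R, thb]) (if c t < q then f t else 0)%:E).
Proof.
move=> mc; apply: cvg_lim => //; apply/cvg_at_leftP => u [uq cu].
apply: fine_cvg; rewrite fineK; last first.
  by apply: integrable_fin_num => //; apply: integrable_if; exact: measurable_if_lt.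
apply: (@dominated_cvg _ _ _ mu _ _ _ _ (EFin \o f)) => //.
- by move=> n; apply/measurable_EFinP; exact: measurable_if_le.
- move=> t tT; case: ltP => cq.
    by apply: cvg_near_cst; apply: filterS (cvgr_gt _ cu _ cq) => n /ltW ->.
  by apply: cvg_near_cst; apply: nearW => n; rewrite leNgt (lt_le_trans (uq n) cq).
- exact: f_integrable.
- move=> n t tT; rewrite /= lee_fin.
  by case: ifP => _; rewrite ?normr0 ?ger0_norm// f_ge0.
Qed.

(* Status gained by a buyer at level [q] from a buyer at level [r]. *)
Definition win (q r : R) : R := if r < q then 1 else if r <= q then 1 / 2 else 0.

Lemma win_range q r : 0 <= win q r <= 1.
Proof. by rewrite /win; case: ltP => _; [|case: ifP => _]; lra. Qed.

Lemma win_sym q r : win q r + win r q = 1.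
Proof. by rewrite /win; case: (ltgtP q r) => _; lra. Qed.

Definition density : R -> R := f \_ `[0, thb].

Lemma density_ge0 t : 0 <= density t.
Proof.
rewrite /density patchE; case: ifPn => // /set_mem; exact: f_ge0.
Qed.

Lemma density_meas : measurable_fun setT density.
Proof. exact/(measurable_restrictT _ _).1. Qed.

Lemma integral_density (h : R -> R) :
  (\int[mu]_t (density t * h t)%:E = \int[mu]_(t in `[0%R, thb]) (f t * h t)%:E)%E.
Proof.
rewrite [RHS]integral_mkcond; apply: eq_integral => t _.
rewrite /density !patchE; case: ifP => _ //.
by rewrite mul0r.
Qed.

(** Writes the status at level [q] as an average of [win q] over opponents, so that types can be
    compared in pairs. *)
Lemma mass_half (c : R -> R) (q : R) : measurable_fun `[0, thb] c ->
  ((fine (\int[mu]_(t in `[0%R, thb]) (if c t < q then f t else 0)%:E) +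
   fine (\int[mu]_(t in `[0%R, thb]) (if c t <= q then f t else 0)%:E)) / 2)%R =
  fine (\int[mu]_(t in `[0%R, thb]) (f t * win q (c t))%:E)%E.
Proof.
move=> mc; rewrite -!/(Rintegral _ _ _) -RintegralD//.
- rewrite mulrC -RintegralZl//.
    apply: eq_Rintegral => t _; rewrite /win.
    by case: ltP => cq; case: ifP => //; [lra|move/negP => []; exact: ltW|lra|lra].
  apply: (@eq_integrable _ _ _ mu _ _ ((fun t => (if c t < q then f t else 0)%:E) \+
     (fun t => (if c t <= q then f t else 0)%:E))%E) => //.
  apply: integrableD => //; apply: integrable_if.
    exact: measurable_if_lt.
  exact: measurable_if_le.
- by apply: integrable_if; exact: measurable_if_lt.
- by apply: integrable_if; exact: measurable_if_le.
Qed.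

(** * Measurability and range of the status under an allocation *)

Section Chi.
Variable chi : R -> R -> R.
Hypothesis chi_alloc : allocation thb chi.

(* [chi] extended by 0, so that Tonelli applies on the whole plane. *)
Definition ext : R * R -> R := (fun p => chi p.1 p.2) \_ (`[0, thb] `*` `[0, 1]).

Lemma ext_in th om : th \in `[0, thb] -> om \in `[0, 1] -> ext (th, om) = chi th om.
Proof. by move=> thT omI; rewrite /ext patchE mem_set. Qed.

Lemma ext_meas : measurable_fun setT ext.
Proof.
apply/(measurable_restrictT _ _).1; last by case: chi_alloc.
by apply: measurableX.
Qed.

Lemma chi_section om : om \in `[0, 1] -> measurable_fun `[0, thb] (chi ^~ om).
Proof.
move=> omI; apply: (eq_measurable_fun (fun t => ext (t, om))).
  by move=> t; rewrite inE => tT; rewrite ext_in.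
apply: measurable_funTS; exact: measurable_fun_pair1 ext_meas.
Qed.

(** The status that results if level 0 is ranked like any other level; it equals the status at
    positive levels and bounds it from above at level 0. *)
Definition standing (p : R * R) : \bar R :=
  (\int[mu]_t (density t * win (ext p) (ext (t, p.2)))%:E)%E.

Lemma measurable_win d (S : measurableType d) (a b : S -> R) :
  measurable_fun setT a -> measurable_fun setT b ->
  measurable_fun setT (fun x => win (a x) (b x)).
Proof.
move=> ma mb; apply: measurable_fun_ifT => //; first exact: measurable_fun_ltr.
by apply: measurable_fun_ifT => //; exact: measurable_fun_ler.
Qed.

Lemma standing_meas : measurable_fun setT standing.
Proof.
have H := @measurable_fun_fubini_tonelli_F _ _ (R * R)%type _ R mu
  (fun z => (density z.2 * win (ext z.1) (ext (z.2, z.1.2)))%:E).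
apply: H.
- apply/measurable_EFinP; apply: measurable_funM.
    by apply: measurableT_comp => //; exact: density_meas.
  apply: measurable_win; first exact: measurableT_comp ext_meas _.
  apply: (measurableT_comp ext_meas).
  apply: measurable_fun_pair => //.
  exact: measurableT_comp.
- move=> z; rewrite lee_fin mulr_ge0 ?density_ge0//.
  by have /andP[] := win_range (ext z.1) (ext (z.2, z.1.2)).
Qed.

Lemma standing_ge0 p : (0 <= standing p)%E.
Proof.
apply: integral_ge0 => t _; rewrite lee_fin mulr_ge0 ?density_ge0//.
by have /andP[] := win_range (ext p) (ext (t, p.2)).
Qed.

Lemma standing_le1 p : (standing p <= 1)%E.
Proof.
rewrite /standing integral_density -f_mass; apply: ge0_le_integral => //.
- move=> t tT; rewrite lee_fin mulr_ge0 ?f_ge0//.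
  by have /andP[] := win_range (ext p) (ext (t, p.2)).
- apply/measurable_EFinP; apply: measurable_funM => //.
  apply: measurable_funTS; apply: measurable_win; first exact: measurable_cst.
  exact: measurable_fun_pair1 ext_meas.
- exact/measurable_EFinP.
- move=> t tT; rewrite lee_fin ler_piMr ?f_ge0//.
  by have /andP[] := win_range (ext p) (ext (t, p.2)).
Qed.

Lemma standing_fin p : standing p \is a fin_num.
Proof.
by rewrite ge0_fin_numE ?standing_ge0// (le_lt_trans (standing_le1 p))// ltry.
Qed.

Lemma status_standing th om : th \in `[0, thb] -> om \in `[0, 1] ->
  status (Gchim thb f chi om) (Gchi thb f chi om) (chi th om) =
  if 0 < ext (th, om) then fine (standing (th, om)) else 0.
Proof.
move=> thT omI; rewrite /status ext_in//; case: ifP => // c0.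
rewrite /Gchim /Gchi left_limit_mass; last exact: chi_section.
rewrite mass_half; last exact: chi_section.
rewrite /standing integral_density ext_in//; congr fine.
by apply: eq_integral => t; rewrite inE => tT; rewrite ext_in.
Qed.

End Chi.
End Allocation.

(** * Necessity *)

Section RankBound.
Variable R : realType.
Local Notation mu := (@lebesgue_measure R).

Lemma tonelli (h : R * R -> \bar R) : measurable_fun setT h -> (forall p, 0 <= h p)%E ->
  (\int[mu]_x \int[mu]_y h (x, y) = \int[mu]_y \int[mu]_x h (x, y))%E.
Proof. by move=> mh h0; have H := @fubini_tonelli _ _ _ _ R mu mu h; apply: H. Qed.

Lemma tonelli_measF (h : R * R -> \bar R) : measurable_fun setT h -> (forall p, 0 <= h p)%E ->
  measurable_fun setT (fun x => \int[mu]_y h (x, y))%E.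
Proof.
by move=> mh h0; have H := @measurable_fun_fubini_tonelli_F _ _ _ _ R mu h; apply: H.
Qed.

Lemma tonelli_measG (h : R * R -> \bar R) : measurable_fun setT h -> (forall p, 0 <= h p)%E ->
  measurable_fun setT (fun y => \int[mu]_x h (x, y))%E.
Proof.
by move=> mh h0; have H := @measurable_fun_fubini_tonelli_G _ _ _ _ R mu h; apply: H.
Qed.

Variables (u v c : R -> R).
Hypotheses (u_meas : measurable_fun setT u) (v_meas : measurable_fun setT v)
  (c_meas : measurable_fun setT c).
Hypotheses (u0 : forall x, 0 <= u x) (v0 : forall x, 0 <= v x).
Variables m n : R.
Hypotheses (um : (\int[mu]_x (u x)%:E = m%:E)%E) (vn : (\int[mu]_x (v x)%:E = n%:E)%E).

Lemma double_integral (a b : R -> R) (k l : R) :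
  measurable_fun setT a -> measurable_fun setT b ->
  (forall x, 0 <= a x) -> (forall x, 0 <= b x) ->
  (\int[mu]_x (a x)%:E = k%:E)%E -> (\int[mu]_x (b x)%:E = l%:E)%E ->
  (\int[mu]_x \int[mu]_y (a x * b y)%:E = (k * l)%:E)%E.
Proof.
move=> ma mb a0 b0 ak bl.
under eq_integral => x _.
  under eq_integral do rewrite EFinM.
  rewrite ge0_integralZl_EFin//; last exact/measurable_EFinP;
    last by move=> y _; rewrite lee_fin.
  rewrite bl; over.
rewrite ge0_integralZr//; last first.
- by rewrite -bl; apply: integral_ge0 => x _; rewrite lee_fin.
- by move=> y _; rewrite lee_fin.
- exact/measurable_EFinP.
by rewrite ak.
Qed.

Lemma measurable_winM (a b : R -> R) : measurable_fun setT a -> measurable_fun setT b ->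
  measurable_fun setT (fun p : R * R => (a p.1 * (b p.2 * win R (c p.1) (c p.2)))%:E).
Proof.
move=> ma mb; apply/measurable_EFinP; apply: measurable_funM.
  exact: measurableT_comp.
apply: measurable_funM; first exact: measurableT_comp.
by apply: measurable_win; exact: measurableT_comp.
Qed.

Lemma winM_ge0 (a b : R -> R) (p : R * R) : (forall x, 0 <= a x) -> (forall x, 0 <= b x) ->
  (0 <= (a p.1 * (b p.2 * win R (c p.1) (c p.2)))%:E)%E.
Proof.
by move=> a0 b0; rewrite lee_fin !mulr_ge0//; have /andP[] := win_range R (c p.1) (c p.2).
Qed.

(** Exchanging the two variables leaves the double integral unchanged and swaps the arguments of
    [win]; by [win_sym] twice the integral is [m^2]. *)
Lemma self_rank : (\int[mu]_x \int[mu]_y (u x * (u y * win R (c x) (c y)))%:E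
  = (m ^+ 2 / 2)%:E)%E.
Proof.
pose h (p : R * R) := (u p.1 * (u p.2 * win R (c p.1) (c p.2)))%:E.
pose h' (p : R * R) := h (p.2, p.1).
have mh : measurable_fun setT h by exact: measurable_winM.
have mh' : measurable_fun setT h'.
  by apply: (measurableT_comp mh); exact: measurable_fun_pair.
have h0 p : (0 <= h p)%E by exact: winM_ge0.
have h'0 p : (0 <= h' p)%E by exact: h0.
set X := (\int[mu]_x \int[mu]_y h (x, y))%E.
have XE : (X = \int[mu]_x \int[mu]_y h' (x, y))%E by rewrite /X tonelli.
have XX : (X + X = (m * m)%:E)%E.
  rewrite {2}XE -ge0_integralD//; last 4 first.
  - by move=> x _; exact: integral_ge0.
  - exact: tonelli_measF.
  - by move=> x _; exact: integral_ge0.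
  - exact: tonelli_measF.
  rewrite -(double_integral u u m m)//; apply: eq_integral => x _.
  rewrite -ge0_integralD//.
  - apply: eq_integral => y _; rewrite /h' /h /= -EFinD; congr EFin.
    by have := win_sym R (c x) (c y); move: (win _ _ _) (win _ _ _) => w w'; nra.
  - exact: measurable_fun_pair2 mh.
  - exact: measurable_fun_pair2 mh'.
have X0 : (0 <= X)%E by apply: integral_ge0 => x _; exact: integral_ge0.
(* [X + X] is finite, which excludes infinite values of [X]. *)
rewrite -/X; move: X XX X0 {XE} => [X||]//= [XX] _; congr EFin.
by rewrite expr2 -XX; lra.
Qed.

(** Here [u] and [v] are the densities of two groups of types and [c] gives the levels in one state.
    Inside the first group the total is [m^2/2] by [self_rank]; against the second, [win <= 1] gives
    at most [m * n]. *)
Lemma pair_rank : (\int[mu]_x ((u x)%:E * \int[mu]_y ((u y + v y) * win R (c x) (c y))%:E)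
  <= (m ^+ 2 / 2 + m * n)%:E)%E.
Proof.
pose h (w : R -> R) (p : R * R) := (u p.1 * (w p.2 * win R (c p.1) (c p.2)))%:E.
have mh w : measurable_fun setT w -> measurable_fun setT (h w) by exact: measurable_winM.
have h0 w p : (forall x, 0 <= w x) -> (0 <= h w p)%E by exact: winM_ge0.
rewrite [leLHS](_ : _ = \int[mu]_x (\int[mu]_y h u (x, y) + \int[mu]_y h v (x, y)))%E.
  rewrite ge0_integralD//; last 4 first.
  - by move=> x _; apply: integral_ge0 => y _; exact: h0.
  - by apply: tonelli_measF => [|p]; [exact: mh|exact: h0].
  - by move=> x _; apply: integral_ge0 => y _; exact: h0.
  - by apply: tonelli_measF => [|p]; [exact: mh|exact: h0].
  rewrite [X in (X + _)%E]self_rank EFinD leeD2l// -(double_integral u v m n)//.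
  apply: ge0_le_integral => //.
  - by move=> x _; apply: integral_ge0 => y _; exact: h0.
  - by apply: tonelli_measF => [|p]; [exact: mh|exact: h0].
  - apply: (tonelli_measF (fun p => (u p.1 * v p.2)%:E)) => [|p].
      by apply/measurable_EFinP; apply: measurable_funM; exact: measurableT_comp.
    by rewrite lee_fin mulr_ge0.
  - move=> x _; apply: ge0_le_integral => //.
    + by move=> y _; exact: h0.
    + exact: measurable_fun_pair2 (mh v v_meas).
    + by apply/measurable_EFinP; apply: measurable_funM.
    + move=> y _; rewrite lee_fin /=; have /andP[w0 w1] := win_range R (c x) (c y).
      by rewrite ler_wpM2l// ler_piMr.
apply: eq_integral => x _.
rewrite -ge0_integralD//; last 4 first.
- by move=> y _; exact: h0.
- exact: measurable_fun_pair2 (mh u u_meas).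
- by move=> y _; exact: h0.
- exact: measurable_fun_pair2 (mh v v_meas).
rewrite -ge0_integralZl_EFin//.
- by apply: eq_integral => y _; rewrite /h /= -EFinM -EFinD; congr EFin; ring.
- move=> y _; rewrite lee_fin mulr_ge0 ?addr_ge0//.
  by have /andP[] := win_range R (c x) (c y).
- apply/measurable_EFinP; apply: measurable_funM; first exact: measurable_funD.
  by apply: measurable_win => //; exact: measurable_cst.
Qed.

End RankBound.

(** * The bound on the total interim status of the top types *)

Section Necessity.
Variables (R : realType) (thb : R) (f : R -> R).
Local Notation mu := (@lebesgue_measure R).
Hypothesis f_meas : measurable_fun `[0, thb] f.
Hypothesis f_ge0 : forall t, t \in `[0, thb] -> 0 <= f t.
Hypothesis f_mass : (\int[mu]_(t in `[0%R, thb]) (f t)%:E = 1)%E.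
Variable chi : R -> R -> R.
Hypothesis chi_alloc : allocation thb chi.

Local Notation standing := (standing R thb f chi).
Local Notation ext := (ext R thb chi).

Definition status_at (p : R * R) : R := if 0 < ext p then fine (standing p) else 0.

Lemma status_at_meas : measurable_fun setT status_at.
Proof.
apply: measurable_fun_ifT => //.
- by apply: measurable_fun_ltr => //; exact: ext_meas.
- by apply: measurableT_comp => //; exact: standing_meas.
Qed.

Lemma status_at_range p : 0 <= status_at p <= 1.
Proof.
rewrite /status_at; case: ifP => _; last by rewrite lexx ler01.
rewrite fine_ge0 ?standing_ge0//= -lee_fin fineK ?standing_fin//.
exact: standing_le1.
Qed.

Lemma interimE th : th \in `[0, thb] ->
  interim thb f chi th = \int[mu]_(om in `[0, 1]) status_at (th, om).
Proof.
move=> thT; rewrite /interim /Rintegral; congr fine; apply: eq_integral => om.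
by rewrite inE => omI; rewrite (status_standing R thb f).
Qed.

Lemma status_at_integrable th :
  mu.-integrable `[0, 1] (fun om => (status_at (th, om))%:E).
Proof.
apply: (bounded_itv_integrable R 0 1 1 (fun om => status_at (th, om))).
  by apply: measurable_funTS; exact: measurable_fun_pair2 status_at_meas.
by move=> om _; have /andP[s0 s1] := status_at_range (th, om); rewrite ger0_norm.
Qed.

(** Ranking excluded buyers instead of giving them status 0 can only raise the integrand. *)
Lemma interim_le_standing th : th \in `[0, thb] ->
  ((interim thb f chi th)%:E <= \int[mu]_(om in `[0%R, 1%R]) standing (th, om))%E.
Proof.
move=> thT; rewrite interimE// /Rintegral fineK; last first.
  by apply: integrable_fin_num => //; exact: status_at_integrable.
apply: ge0_le_integral => //.
- by move=> om _; rewrite lee_fin; have /andP[] := status_at_range (th, om).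
- apply/measurable_EFinP; apply: measurable_funTS; exact: measurable_fun_pair2 status_at_meas.
- apply: measurable_funTS; apply: measurable_fun_pair2; exact: standing_meas.
- move=> om _; rewrite /status_at; case: ifP => _; last exact: standing_ge0.
  by rewrite fineK// standing_fin.
Qed.

(** In each state [pair_rank] bounds the total status of the types above [x] by
    [m^2/2 + m (1 - m) = m - m^2/2]; averaging over states keeps the bound. *)
Lemma interim_mass_le (s : R -> R) (x m : R) : x \in `[0, thb] ->
  measurable_fun `[0, thb] s -> (forall th, th \in `[0, thb] -> 0 <= s th) ->
  (forall th, th \in `[0, thb] -> s th = interim thb f chi th) ->
  m = \int[mu]_(t in `[x, thb]) f t ->
  (\int[mu]_(t in `[x, thb]) (s t * f t)%:E <= (m - m ^+ 2 / 2)%:E)%E.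
Proof.
move=> xT ms s0 sE mE.
have := xT; rewrite in_itv/= => /andP[x0 xb].
have sub : `[x, thb] `<=` `[0, thb] by apply: subset_itvr; rewrite bnd_simp.
have subo : `[0, x[ `<=` `[0, thb] by apply: subset_itv; rewrite bnd_simp.
(* [u] carries the types from [x] on, [v] those below [x]. *)
pose u : R -> R := f \_ `[x, thb]; pose v : R -> R := f \_ `[0, x[.
have u_meas : measurable_fun setT u.
  by apply/(measurable_restrictT _ _).1 => //; exact: measurable_funS f_meas.
have mv : measurable_fun setT v.
  by apply/(measurable_restrictT _ _).1 => //; exact: measurable_funS f_meas.
have u0 t : 0 <= u t.
  by rewrite /u patchE; case: ifPn => // /set_mem /sub; exact: f_ge0.
have v0 t : 0 <= v t.
  by rewrite /v patchE; case: ifPn => // /set_mem /subo; exact: f_ge0.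
have duv t : density R thb f t = u t + v t.
  rewrite /density /u /v !patchE; have [t0|t0] := boolP (t \in [set` `[0, thb]]).
    move: (t0); rewrite inE/= in_itv/= => /andP[t0' tb].
    have [tx|tx] := leP x t.
      rewrite mem_set/= ?in_itv/= ?tx// memNset/= ?addr0//.
      by rewrite in_itv/= ltNge tx andbF.
    rewrite memNset/= ?in_itv/= ?leNgt ?tx// mem_set/= ?add0r//.
    by rewrite in_itv/= t0'.
  rewrite memNset; last by move=> /sub/mem_set; rewrite (negbTE t0).
  by rewrite memNset ?addr0// => /subo/mem_set; rewrite (negbTE t0).
have fi := f_integrable R thb f f_meas f_ge0 f_mass.
have um : (\int[mu]_t (u t)%:E = m%:E)%E.
  rewrite mE /Rintegral fineK; last first.
    by apply: integrable_fin_num => //; exact: integrableS fi.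
  by rewrite [RHS]integral_mkcond; apply: eq_integral => t _; rewrite /u !patchE; case: ifP.
have vn : (\int[mu]_t (v t)%:E = (1 - m)%:E)%E.
  have : (\int[mu]_t (u t)%:E + \int[mu]_t (v t)%:E = 1)%E.
    rewrite -ge0_integralD//; [|by move=> t _; rewrite lee_fin|exact/measurable_EFinP
      |by move=> t _; rewrite lee_fin|exact/measurable_EFinP].
    rewrite -f_mass [RHS]integral_mkcond; apply: eq_integral => t _.
    by rewrite -EFinD -duv /density !patchE; case: ifP.
  rewrite um; case: (\int[mu]_t (v t)%:E)%E => [r||]//= [<-]; congr EFin; ring.
(* The indicator of the states makes the integrand live on the whole plane, ready for Tonelli. *)
pose Z (p : R * R) : \bar R :=
  ((u p.1)%:E * (standing p * (\1_(`[0%R, 1%R] : set R) p.2)%:E))%E.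
have mZ : measurable_fun setT Z.
  apply: emeasurable_funM; first by apply/measurable_EFinP; exact: measurableT_comp.
  apply: emeasurable_funM; first exact: standing_meas.
  apply/measurable_EFinP; apply: measurableT_comp => //.
have Z0 p : (0 <= Z p)%E.
  by rewrite /Z !mule_ge0 ?lee_fin// standing_ge0.
have msec th : measurable_fun setT (fun om => standing (th, om)).
  by apply: measurable_fun_pair2; exact: standing_meas.
apply: (@le_trans _ _ (\int[mu]_t \int[mu]_om Z (t, om))%E).
  rewrite integral_mkcond; apply: ge0_le_integral => //.
  - move=> t _; rewrite patchE; case: ifPn => // /set_mem tx.
    by rewrite lee_fin mulr_ge0 ?s0 ?f_ge0//; exact: sub.
  - apply/(measurable_restrictT _ _).1 => //; apply/measurable_EFinP.
    by apply: measurable_funM; [exact: measurable_funS ms|exact: measurable_funS f_meas].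
  - exact: tonelli_measF.
  - move=> t _; rewrite patchE; case: ifPn => [/set_mem tx|_]; last exact: integral_ge0.
    rewrite /Z /= ge0_integralZl_EFin//; last 2 first.
    + by move=> om _; rewrite mule_ge0 ?lee_fin ?standing_ge0.
    + apply: emeasurable_funM; first exact: msec.
      by apply/measurable_EFinP.
    rewrite (_ : u t = f t); last by rewrite /u patchE mem_set.
    rewrite mulrC EFinM; apply: lee_wpmul2l; first by rewrite lee_fin f_ge0//; exact: sub.
    rewrite (sE t (sub _ tx)).
    apply: (le_trans (interim_le_standing _ (sub _ tx))).
    rewrite le_eqVlt; apply/orP; left; apply/eqP.
    rewrite [LHS]integral_mkcond; apply: eq_integral => om _.
    by rewrite patchE indicE; case: ifP => _; rewrite ?mule1 ?mule0.
(* With the state as outer variable, [pair_rank] applies state by state. *)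
rewrite tonelli//.
have -> : (m - m ^+ 2 / 2)%:E = (\int[mu]_(om in `[0%R, 1%R]) (m ^+ 2 / 2 + m * (1 - m))%:E)%E.
  rewrite integral_cst//= lebesgue_measure_itv/= lte_fin ltr01 oppr0 adde0 mule1.
  by congr EFin; field.
rewrite [leRHS]integral_mkcond; apply: ge0_le_integral => //.
- by move=> om _; exact: integral_ge0.
- exact: tonelli_measG.
- by apply/(measurable_restrictT _ _).1.
- move=> om _; rewrite patchE; case: ifPn => [/set_mem omI|omI]; last first.
    rewrite integral0_eq// => t _; rewrite /Z /= indicE (negbTE omI).
    by rewrite !mule0.
  have mc : measurable_fun setT (fun t => ext (t, om)).
    exact: measurable_fun_pair1 (ext_meas _ _ _ chi_alloc).
  rewrite (le_trans _ (pair_rank R u v _ u_meas mv mc u0 v0 m (1 - m) um vn))//.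
  rewrite le_eqVlt; apply/orP; left; apply/eqP; apply: eq_integral => t _.
  rewrite /Z /= indicE mem_set//= mule1; congr (_ * _)%E.
  by apply: eq_integral => t' _; rewrite duv.
Qed.

End Necessity.

(** * The nondecreasing convex envelope and its pools *)

Section Envelope.
Variables (R : realType) (thb : R) (F K s : R -> R).
Hypotheses (thb_ge0 : 0 <= thb) (F_cont : continuous F) (K_cont : continuous K).
Hypotheses (F0 : F 0 = 0) (Fthb : F thb = 1).
Hypothesis F_incr : forall x y, x \in `[0, thb] -> y \in `[0, thb] -> x < y -> F x < F y.
Hypothesis s_range : forall x, x \in `[0, thb] -> 0 <= s x <= 1.
Hypothesis s_subgrad : forall x y, x \in `[0, thb] -> y \in `[0, thb] ->
  s x * (F y - F x) <= K y - K x.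
Hypothesis K_ge : forall x, x \in `[0, thb] -> F x ^+ 2 / 2 <= K x.
Hypothesis Kthb : K thb = 1 / 2.

(** The maximum over [z] is the Legendre conjugate, at slope [p], of [K - (1 - t) F^2/2] seen as a
    function of [F]; the maximizers are the contact points of the supporting line of slope [p]. *)
Definition payoff (p t z : R) : R := p * F z - (K z - (1 - t) * F z ^+ 2 / 2).

Definition ismax (p t z : R) : Prop :=
  z \in `[0, thb] /\ forall y, y \in `[0, thb] -> payoff p t y <= payoff p t z.

Lemma F_le x y : x \in `[0, thb] -> y \in `[0, thb] -> x <= y -> F x <= F y.
Proof.
move=> xT yT; rewrite le_eqVlt => /predU1P[->//|xy].
by rewrite ltW// F_incr.
Qed.

Lemma zero_in : 0 \in `[0, thb]. Proof. by rewrite in_itv/= lexx. Qed.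
Lemma thb_in : thb \in `[0, thb]. Proof. by rewrite in_itv/= lexx thb_ge0. Qed.

Lemma F_range x : x \in `[0, thb] -> 0 <= F x <= 1.
Proof.
move=> xT; have := xT; rewrite in_itv/= => /andP[x0 xb].
by rewrite -F0 -Fthb !F_le ?zero_in ?thb_in.
Qed.

Lemma payoff_continuous p t : continuous (payoff p t).
Proof.
move=> z; rewrite /payoff; apply: cvgB.
  by apply: cvgM; [exact: cvg_cst|exact: F_cont].
apply: cvgB; first exact: K_cont.
apply: cvgM; last exact: cvg_cst.
apply: cvgM; first exact: cvg_cst.
by rewrite expr2; apply: cvgM; exact: F_cont.
Qed.

Lemma payoff_max p t a b : 0 <= a -> a <= b -> b <= thb ->
  exists2 z, z \in `[a, b] & forall y, y \in `[a, b] -> payoff p t y <= payoff p t z.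
Proof.
move=> a0 ab bT; apply: EVT_max => //.
by apply: continuous_subspaceT => x; exact: payoff_continuous.
Qed.

(** Monotone comparative statics: the payoff has strictly increasing differences in [p] and [z]. *)
Lemma ismax_lt p p' t y y' : ismax p t y -> ismax p' t y' -> p < p' -> y <= y'.
Proof.
move=> [yT ymax] [y'T y'max] pp'; rewrite leNgt; apply/negP => /F_incr-/(_ y'T yT) FF.
have := ymax _ y'T; have := y'max _ yT; rewrite /payoff => h1 h2.
nra.
Qed.

Lemma argmaxP p t : exists ab : R * R, [/\ ismax p t ab.1, ismax p t ab.2 &
  forall z, ismax p t z -> ab.1 <= z <= ab.2].
Proof.
have [m mT mmax] := payoff_max p t 0 thb (lexx _) thb_ge0 (lexx _).
pose X := [set` `[0, thb]] `&` (payoff p t @^-1` [set y | payoff p t m <= y]).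
have XE z : X z <-> ismax p t z.
  split=> [[zT /= zm]|[zT zm]]; split => //.
    by move=> y yT; rewrite (le_trans (mmax y yT)).
  exact: zm.
have cX : compact X.
  apply: compact_closedI; first exact: segment_compact.
  apply: closed_comp; first by move=> x _; exact: payoff_continuous.
  exact: closed_ge.
have X0 : X !=set0 by exists m; apply/XE.
have cid : {within X, continuous (id : R -> R)}.
  by apply: continuous_subspaceT => x; exact: cvg_id.
have [b bX bmax] := compact_EVT_max X0 cX cid.
have [a aX amin] := compact_EVT_min X0 cX cid.
exists (a, b); split=> /=.
- by apply/XE; rewrite inE in aX.
- by apply/XE; rewrite inE in bX.
- by move=> z /XE zX; rewrite amin ?inE// bmax ?inE.
Qed.

(* Types in [[lo p t, hi p t]] have a supporting line of slope [p] in state [t]. *)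
Definition lo p t : R := (projT1 (cid (argmaxP p t))).1.
Definition hi p t : R := (projT1 (cid (argmaxP p t))).2.

Lemma lo_max p t : ismax p t (lo p t).
Proof. by rewrite /lo; case: cid => -[a b] []. Qed.
Lemma hi_max p t : ismax p t (hi p t).
Proof. by rewrite /hi; case: cid => -[a b] []. Qed.
Lemma lo_le p t z : ismax p t z -> lo p t <= z.
Proof. by rewrite /lo; case: cid => -[a b] [/= _ _ h] /h /andP[]. Qed.
Lemma hi_ge p t z : ismax p t z -> z <= hi p t.
Proof. by rewrite /hi; case: cid => -[a b] [/= _ _ h] /h /andP[]. Qed.

Lemma hi_mono p p' t : p <= p' -> hi p t <= hi p' t.
Proof.
rewrite le_eqVlt => /predU1P[->//|]; exact: ismax_lt (hi_max _ _) (hi_max _ _).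
Qed.

(** Lowering [t] adds a multiple of [F^2/2], which favours higher types: were [hi p t < hi p t'],
    the latter would also be a maximizer in state [t]. *)
Lemma hi_anti p t t' : t <= t' -> hi p t' <= hi p t.
Proof.
move=> tt'; rewrite leNgt; apply/negP => hh.
have [yT ymax] := hi_max p t; have [y'T y'max] := hi_max p t'.
have FF := F_incr _ _ yT y'T hh.
suff /hi_ge : ismax p t (hi p t') by rewrite leNgt hh.
split=> // z zT; apply: (le_trans (ymax _ zT)).
have /andP[Fy0 _] := F_range _ yT.
have : 0 <= (t' - t) * ((F (hi p t') - F (hi p t)) * (F (hi p t') + F (hi p t))).
  by rewrite !mulr_ge0//; lra.
have := y'max _ yT; rewrite /payoff; lra.
Qed.

(** Since [s thb <= 1], every chord of [K] ending at [thb] has [F]-slope at most 1. This caps the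
    levels at 1. *)
Lemma hi1 t : t \in `[0, 1] -> hi 1 t = thb.
Proof.
rewrite in_itv/= => /andP[t0 t1].
apply/eqP; rewrite eq_le; apply/andP; split.
  by have [] := hi_max 1 t; rewrite in_itv/= => /andP[].
apply: hi_ge; split; first exact: thb_in.
move=> y yT; rewrite /payoff Fthb.
have := s_subgrad _ _ thb_in yT; rewrite Fthb.
have /andP[s0 s1] := s_range _ thb_in; have /andP[y0 y1] := F_range _ yT.
have : 0 <= (1 - t) * (1 - F y ^+ 2).
  by apply: mulr_ge0; [lra|rewrite subr_ge0 expr_le1].
nra.
Qed.

(* The left slope of the envelope, as a function of [F], at [x]. *)
Definition level x t : R := inf [set p | 0 <= p /\ x <= hi p t].

Lemma level_ge0 x t : 0 <= level x t.
Proof.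
(* The infimum of the empty set is 0 by default. *)
rewrite /level; have [->|/set0P A0] := eqVneq [set p | 0 <= p /\ x <= hi p t] set0.
  by rewrite inf0.
by apply: lb_le_inf => // p [].
Qed.

Lemma hi_level_le x t p : 0 <= p -> x <= hi p t -> level x t <= p.
Proof.
move=> p0 xp; apply: ge_inf => //.
by exists 0 => q [].
Qed.

Lemma level_le1 x t : x \in `[0, thb] -> t \in `[0, 1] -> level x t <= 1.
Proof.
move=> xT tI; apply: hi_level_le => //; rewrite hi1//.
by move: xT; rewrite in_itv/= => /andP[].
Qed.

Lemma level_lt x t p : x \in `[0, thb] -> t \in `[0, 1] -> level x t < p ->
  exists q, [/\ 0 <= q, q < p & x <= hi q t].
Proof.
move=> xT tI /inf_lt[|q [q0 xq] qp]; last by exists q.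
exists 1; split => //; rewrite hi1//.
by move: xT; rewrite in_itv/= => /andP[].
Qed.

Lemma payoff_shift p q t z : payoff q t z = payoff p t z + (q - p) * F z.
Proof. rewrite /payoff; ring. Qed.

(** As [F] lies in [[0, 1]], raising the slope by [e] changes payoff differences by at most [e].
    Hence the best point of [[x, thb]] is optimal at slope [q] up to every [e > 0]. The infimum in
    [level] is therefore attained. *)
Lemma hi_right_closed x t q : x \in `[0, thb] ->
  (forall p, q < p -> x <= hi p t) -> x <= hi q t.
Proof.
move=> xT hx; have := xT; rewrite in_itv/= => /andP[x0 xb].
have [m mx mmax] := payoff_max q t x thb x0 xb (lexx _).
move: (mx); rewrite in_itv/= => /andP[xm mT].
have mT' : m \in `[0, thb] by rewrite in_itv/= mT (le_trans x0).
apply: (le_trans xm); apply: hi_ge; split => // z zT.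
apply/ler_addgt0Pr => e e0.
have qe : q < q + e by rewrite ltrDl.
have [bT bmax] := hi_max (q + e) t.
have := bmax _ zT; rewrite !(payoff_shift q (q + e)).
have := mmax (hi (q + e) t); rewrite in_itv/= hx//=.
move: (bT); rewrite in_itv/= => /andP[_ ->] /(_ isT).
have /andP[? ?] := F_range _ zT; have /andP[? ?] := F_range _ bT.
nra.
Qed.

(** Mirror image of [hi_right_closed]: slopes increase to [q], and the best point of [[0, x]] is
    optimal in the limit. *)
Lemma lo_left_closed x t q : x \in `[0, thb] -> 0 < q ->
  (forall p, 0 <= p -> p < q -> hi p t < x) -> lo q t <= x.
Proof.
move=> xT q0 hx; have := xT; rewrite in_itv/= => /andP[x0 xb].
have [m mx mmax] := payoff_max q t 0 x (lexx _) x0 xb.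
move: (mx); rewrite in_itv/= => /andP[m0 mlex].
have mT' : m \in `[0, thb] by rewrite in_itv/= m0 (le_trans mlex).
apply: (le_trans _ mlex); apply: lo_le; split => // z zT.
apply/ler_addgt0Pr => e e0.
(* The hypothesis covers nonnegative slopes only, hence the truncation at 0. *)
pose p := Num.max 0 (q - e).
have p0 : 0 <= p by rewrite le_max lexx.
have pq : p < q by rewrite gt_max q0/=; lra.
have pe : q - e <= p by rewrite le_max lexx orbT.
have [bT bmax] := hi_max p t.
have := bmax _ zT.
have := mmax (hi p t); rewrite in_itv/= (ltW (hx _ _ _))// andbT.
move: (bT); rewrite in_itv/= => /andP[-> _] /(_ isT).
rewrite !(payoff_shift p q).
have /andP[? ?] := F_range _ zT; have /andP[? ?] := F_range _ bT.
nra.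
Qed.

(** This Galois connection between [level] and [hi] yields both the measurability and the
    distribution of the levels. *)
Lemma level_leP x t q : x \in `[0, thb] -> t \in `[0, 1] -> 0 <= q ->
  (level x t <= q) = (x <= hi q t).
Proof.
move=> xT tI q0; apply/idP/idP => [lq|]; last exact: hi_level_le.
apply: hi_right_closed => // p qp.
have [r [r0 rp xr]] := level_lt x t p xT tI (le_lt_trans lq qp).
by rewrite (le_trans xr)// hi_mono// ltW.
Qed.

(** Together with [lt_lo_level], this determines the types of level below [q] up to the single type
    [lo q t]. *)
Lemma level_lt_lo x t q : x \in `[0, thb] -> t \in `[0, 1] ->
  level x t < q -> x <= lo q t.
Proof.
move=> xT tI /(level_lt _ _ _ xT tI)[p [p0 pq xp]]; apply: (le_trans xp).
exact: ismax_lt (hi_max _ _) (lo_max _ _) pq.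
Qed.

Lemma lt_lo_level x t q : x \in `[0, thb] -> 0 < q ->
  x < lo q t -> level x t < q.
Proof.
move=> xT q0; apply: contraTT; rewrite -!leNgt => qlx.
apply: lo_left_closed => // p p0 pq; rewrite ltNge; apply/negP => xp.
have := hi_level_le _ _ _ p0 xp; lra.
Qed.

Definition mass_hi x t := F (hi (level x t) t).
(* At level 0 the pool is extended evenly to negative values of [F]: this makes
   [rank] vanish there and turns exclusion into an ordinary pool. *)
Definition mass_lo x t :=
  if 0 < level x t then F (lo (level x t) t) else - mass_hi x t.

Definition rank x t := (mass_lo x t + mass_hi x t) / 2.

(* The value at [x] of the envelope, recovered from its conjugate. *)
Definition envelope x t := level x t * F x - payoff (level x t) t (hi (level x t) t).

(* Interpolation of [F^2/2] at the endpoints of the pool of [x]. *)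
Definition chord x t :=
  ((mass_lo x t + mass_hi x t) * F x - mass_lo x t * mass_hi x t) / 2.

(** The type [x] lies in its own pool: above by attainment of the infimum, below by
    [lo_left_closed]. The bound -1 allows for the extension at level 0. *)
Lemma mass_bounds x t : x \in `[0, thb] -> t \in `[0, 1] ->
  [/\ -1 <= mass_lo x t, mass_lo x t <= F x, F x <= mass_hi x t & mass_hi x t <= 1].
Proof.
move=> xT tI; have /andP[F0x Fx1] := F_range _ xT.
have xhi : x <= hi (level x t) t by rewrite -level_leP// level_ge0.
have [hT _] := hi_max (level x t) t.
have [lT _] := lo_max (level x t) t.
have /andP[Fh0 Fh1] := F_range _ hT; have /andP[Fl0 Fl1] := F_range _ lT.
have Fxh := F_le _ _ xT hT xhi.
rewrite /mass_lo /mass_hi; case: ifPn => l0; split => //; try lra.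
apply: F_le => //; apply: lo_left_closed => // p p0 pl.
rewrite ltNge; apply/negP => /(hi_level_le _ _ _ p0); lra.
Qed.

(* At a fixed type the envelope is a minimum of chords, which are affine in [t]. *)
Lemma envelope_supgrad x t t' : x \in `[0, thb] -> t \in `[0, 1] -> t' \in `[0, 1] ->
  envelope x t' <= envelope x t + (t' - t) * chord x t.
Proof.
move=> xT tI t'I.
have [_ lox xhi _] := mass_bounds _ _ xT tI.
move: lox xhi; rewrite /envelope /chord /mass_lo /mass_hi.
have [hT hmax] := hi_max (level x t) t.
have [lT lmax] := lo_max (level x t) t.
have [h'T hmax'] := hi_max (level x t') t'.
have q'0 := level_ge0 x t'.
have /andP[Fx0 _] := F_range _ xT.
have /andP[Fh0 _] := F_range _ hT.
(* The maximum in state [t'] is compared with the payoffs there of both ends of the pool of [x] in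
   state [t]. *)
have := hmax' _ hT; have := hmax' _ lT.
have lhE : payoff (level x t) t (lo (level x t) t) = payoff (level x t) t (hi (level x t) t).
  by apply/eqP; rewrite eq_le hmax//= lmax.
have := level_ge0 x t.
set M' := payoff _ t' (hi _ t'); move: lhE; rewrite /payoff.
set q := level x t; set q' := level x t' in q'0 *.
set a := F (lo q t); set b := F (hi q t) in Fh0 *; set Ka := K (lo q t); set Kb := K (hi q t).
(* At level 0 the lower endpoint counts as [-b], so the chord is the constant [b^2/2]. *)
move=> lhE q0 la lb; case: ifPn => [qp|]; last first.
  rewrite -leNgt => qle0 _ xb; have {qle0 q0} -> : q = 0 by lra.
  nra.
move=> ax xb.
have [abE|ab] := eqVneq a b.
  have -> : F x = b by lra.
  move: la; rewrite abE in lhE *; nra.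
(* On a proper pool, the bounds at the two ends are averaged with weights [b - F x] and
   [F x - a]. *)
have ba : 0 < b - a by rewrite subr_gt0 lt_neqAle ab/=; lra.
rewrite -(ler_pM2l ba).
have h1 : 0 <= (b - F x) by lra.
have h2 : 0 <= F x - a by lra.
have {}la := ler_wpM2l h1 la.
have {}lb := ler_wpM2l h2 lb.
have lhE' : (b - F x) * (q * a - (Ka - (1 - t) * a ^+ 2 / 2)) =
    (b - F x) * (q * b - (Kb - (1 - t) * b ^+ 2 / 2)) by rewrite lhE.
lra.
Qed.

(* The line through the pool of [x] lies below [F^2/2] outside this pool, and the
   chord of [y] lies above [F^2/2] at [y]. *)
Lemma rank_subgrad x y t : x \in `[0, thb] -> y \in `[0, thb] -> t \in `[0, 1] ->
  chord x t + rank x t * (F y - F x) <= chord y t.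
Proof.
move=> xT yT tI.
(* The product is twice the gap at [y] between [F^2/2] and the line through the pool of [x]; the
   alternative is that [x] and [y] share a pool. *)
suff H : 0 <= (F y - mass_lo x t) * (F y - mass_hi x t) \/
   (mass_lo x t = mass_lo y t /\ mass_hi x t = mass_hi y t).
  case: H => [H|[]].
    have [_ h1 h2 _] := mass_bounds _ _ yT tI.
    have : (F y - mass_lo y t) * (F y - mass_hi y t) <= 0.
      by rewrite mulr_ge0_le0; lra.
    rewrite /chord /rank; lra.
  by rewrite /chord /rank => -> ->; lra.
have xhi : x <= hi (level x t) t by rewrite -level_leP// level_ge0.
have yhi : y <= hi (level y t) t by rewrite -level_leP// level_ge0.
have [hT _] := hi_max (level x t) t.
have [lT _] := lo_max (level x t) t.
have /andP[Fy0 Fy1] := F_range _ yT.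
have /andP[Fx0 Fx1] := F_range _ xT.
have [_ m1 m2 _] := mass_bounds _ _ xT tI.
have [E|] := eqVneq (level x t) (level y t).
  by right; rewrite /mass_lo /mass_hi E.
rewrite neq_lt => /orP[xy|yx]; left.
  have hy : hi (level x t) t < y.
    rewrite ltNge; apply/negP => /(hi_level_le _ _ _ (level_ge0 _ _)); lra.
  have := F_incr _ _ hT yT hy; rewrite -/(mass_hi x t) => ?.
  by apply: mulr_ge0; lra.
have lx : 0 < level x t by rewrite (le_lt_trans (level_ge0 y t)).
have := level_lt_lo _ _ _ yT tI yx => yl.
have := F_le _ _ yT lT yl => ?.
have ml : mass_lo x t = F (lo (level x t) t) by rewrite /mass_lo lx.
by rewrite -mulrNN; apply: mulr_ge0; lra.
Qed.

(** Majorization enters here: [K - F^2/2] is nonnegative and vanishes at [thb], so its largest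
    nondecreasing convex minorant is 0. *)
Lemma envelope0 x : x \in `[0, thb] -> envelope x 0 = 0.
Proof.
move=> xT; have I0 : 0 \in `[0, 1 : R] by rewrite in_itv/= lexx ler01.
have q0 := level_ge0 x 0; have q1 := level_le1 _ _ xT I0.
have /andP[Fx0 Fx1] := F_range _ xT.
have [hT hmax] := hi_max (level x 0) 0.
have /andP[Fh0 Fh1] := F_range _ hT.
have := hmax _ thb_in; have := K_ge _ hT.
have E : (level x 0 = 0) \/ level x 0 * F (lo (level x 0) 0) <= level x 0 * F x.
  rewrite /envelope; have [l0|l0] := ltP 0 (level x 0).
    right; rewrite ler_pM2l//.
    by have [_ + _ _] := mass_bounds _ _ xT I0; rewrite /mass_lo l0.
  by left; lra.
rewrite /envelope /payoff Fthb Kthb.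
have [lT lmax] := lo_max (level x 0) 0.
have := lmax _ thb_in; have := K_ge _ lT; have := hmax _ lT; have := lmax _ hT.
have /andP[Fl0 Fl1] := F_range _ lT.
rewrite /payoff Fthb Kthb.
have xhi : F x <= F (hi (level x 0) 0).
  by have [_ _ + _] := mass_bounds _ _ xT I0.
move: E q0 q1 xhi hT lT; set q := level x 0.
case=> [->|]; first by move=> *; lra.
move=> *; nra.
Qed.

(** [K] has supporting lines of slope [s x >= 0], so it is nondecreasing and convex in [F] and is
    its own envelope. *)
Lemma envelope1 x : x \in `[0, thb] -> envelope x 1 = K x.
Proof.
move=> xT; have I1 : 1 \in `[0, 1 : R] by rewrite in_itv/= lexx ler01.
have [hT hmax] := hi_max (level x 1) 1.
have xhi : x <= hi (level x 1) 1 by rewrite -level_leP// level_ge0.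
have Fxhi := F_le _ _ xT hT xhi.
apply/eqP; rewrite eq_le; apply/andP; split.
  have := hmax _ xT; rewrite /envelope /payoff; lra.
have /andP[s0 s1] := s_range _ xT.
have hs : x <= hi (s x) 1.
  apply: hi_ge; split => // y yT; have := s_subgrad _ _ xT yT.
  by rewrite /payoff; lra.
have qs : level x 1 <= s x by exact: hi_level_le.
have := s_subgrad _ _ xT hT.
rewrite /envelope /payoff.
nra.
Qed.

Lemma chord_range x t : x \in `[0, thb] -> t \in `[0, 1] -> 0 <= chord x t <= 2.
Proof.
move=> xT tI; have [h1 h2 h3 h4] := mass_bounds _ _ xT tI.
have /andP[Fx0 Fx1] := F_range _ xT.
rewrite /chord; apply/andP; split; nra.
Qed.

(** Supergradients decrease: add the inequalities of [envelope_supgrad] from [t] to [t'] and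
    back. *)
Lemma chord_anti x t t' : x \in `[0, thb] -> t \in `[0, 1] -> t' \in `[0, 1] ->
  t <= t' -> chord x t' <= chord x t.
Proof.
move=> xT tI t'I; rewrite le_eqVlt => /predU1P[->//|tt'].
have := envelope_supgrad _ _ _ xT tI t'I; have := envelope_supgrad _ _ _ xT t'I tI.
nra.
Qed.

Local Notation mu := (@lebesgue_measure R).

Lemma chord_integral x : x \in `[0, thb] ->
  \int[mu]_(t in `[0, 1]) chord x t = K x.
Proof.
move=> xT.
(* The signs are reversed because [subgrad_integral] asks for a nondecreasing integrand. *)
have H : \int[mu]_(t in `[0, 1]) (- chord x t * 1) = - envelope x 1 - - envelope x 0.
  apply: (subgrad_integral R 0 1 1 (fun t => - chord x t) (fun=> 1)
    (fun t => - envelope x t)) => //.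
  - by move=> t t' tI t'I tt'; rewrite lerN2 chord_anti.
  - by move=> u _; rewrite ler01 lexx.
  - move=> t t' tI t'I tt'.
    have -> : \int[mu]_(_ in `[t, t']) (1 : R) = t' - t.
      rewrite Rintegral_cst//= lebesgue_measure_itv/= lte_fin.
      by move: tt'; rewrite le_eqVlt => /predU1P[->|->]; rewrite ?ltxx ?subrr mul1r.
    have := envelope_supgrad _ _ _ xT tI t'I; have := envelope_supgrad _ _ _ xT t'I tI.
    by move=> h1 h2; apply/andP; split; lra.
have cI : mu.-integrable `[0, 1] (EFin \o (fun t => - chord x t)).
  apply: (bounded_itv_integrable R 0 1 2).
    apply: mono_on_measurable => t t' tI t'I tt'; by rewrite lerN2 chord_anti.
  move=> t tI; rewrite normrN.
  by have /andP[c0 c2] := chord_range _ _ xT tI; rewrite ger0_norm.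
have : \int[mu]_(t in `[0, 1]) chord x t =
  -1 * \int[mu]_(t in `[0, 1]) (- chord x t).
  by rewrite -RintegralZl//; apply: eq_Rintegral => t _; ring.
move=> ->; under eq_Rintegral do rewrite -[- chord _ _]mulr1.
rewrite H envelope0// envelope1//; ring.
Qed.

(** Averages [rank_subgrad] over the states; [chord_integral] turns the chords into [K]. *)
Lemma rank_integral_subgrad x y : x \in `[0, thb] -> y \in `[0, thb] ->
  measurable_fun (`[0, 1] : set R) (rank x) ->
  (\int[mu]_(t in `[0, 1]) rank x t) * (F y - F x) <= K y - K x.
Proof.
move=> xT yT mr.
have chordI z : z \in `[0, thb] -> mu.-integrable `[0, 1] (EFin \o chord z).
  move=> zT; apply: (bounded_itv_integrable R 0 1 2).
    rewrite (_ : chord z = fun t => - (- chord z t)); last by apply/funext => t; rewrite opprK.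
    apply/measurable_funN; apply: mono_on_measurable => t t' tI t'I tt'.
    by rewrite lerN2 chord_anti.
  by move=> t tI; have /andP[c0 c2] := chord_range _ _ zT tI; rewrite ger0_norm.
have rankI : mu.-integrable `[0, 1] (EFin \o rank x).
  apply: (bounded_itv_integrable R 0 1 1) => // t tI.
  have [h1 h2 h3 h4] := mass_bounds _ _ xT tI; have /andP[? ?] := F_range _ xT.
  by rewrite ler_norml /rank; apply/andP; split; lra.
have rankZI : mu.-integrable `[0, 1] (EFin \o (fun t => rank x t * (F y - F x))).
  exact: eq_integrable (integrableZr _ (F y - F x) rankI).
rewrite -RintegralZr// lerBrDl -{1}(chord_integral x)// -(chord_integral y)//.
rewrite -RintegralD//; try exact: chordI.
apply: le_Rintegral => //; last by move=> t tI; exact: rank_subgrad.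
- exact: eq_integrable (integrableD _ (chordI x xT) rankZI).
- exact: chordI.
Qed.

(** * The allocation built from the envelope *)

Section Mechanism.
Variables (f : R -> R) (N : set R).
Hypothesis f_meas : measurable_fun `[0, thb] f.
Hypothesis f_ge0 : forall t, t \in `[0, thb] -> 0 <= f t.
Hypothesis f_mass : (\int[mu]_(t in `[0%R, thb]) (f t)%:E = 1)%E.
Hypothesis F_int : forall x, x \in `[0, thb] -> F x = \int[mu]_(t in `[0, x]) f t.
Hypothesis s_mono : forall x y, x \in `[0, thb] -> y \in `[0, thb] -> x <= y -> s x <= s y.
Hypothesis N_countable : countable N.

(* Regular levels are at most 1, so level 2 has status 1. *)
Definition rule (x t : R) : R :=
  if x \in N then (if t <= s x then 2 else 0) else level x t.

Lemma N_measurable : measurable N.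
Proof. exact: countable_measurable. Qed.

Lemma hi_in p t : hi p t \in `[0, thb]. Proof. by have [] := hi_max p t. Qed.
Lemma lo_in p t : lo p t \in `[0, thb]. Proof. by have [] := lo_max p t. Qed.

(** By [level_leP] the level exceeds [q >= 0] exactly when [hi q t < x], and [hi q] is monotone in
    the state. *)
Lemma level_measurable :
  measurable_fun (`[0, thb] `*` `[0, 1] : set (R * R)) (fun p => level p.1 p.2).
Proof.
have mD : measurable (`[0, thb] `*` `[0, 1] : set (R * R)) by exact: measurableX.
apply: (measurability (@RGenOInfty.G R)) => [|/= _ [_] [q] -> <-].
  exact: RGenOInfty.measurableE.
have [q0|q0] := leP 0 q.
  rewrite (_ : _ `&` _ = (`[0, thb] `*` `[0, 1]) `&`
      (fun p : R * R => hi q p.2 < p.1) @^-1` [set true]).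
    have mh : measurable_fun setT (fun p : R * R => hi q p.2 < p.1).
      apply: measurable_fun_ltr => //; apply: measurableT_comp => //.
      by apply: nonincreasing_measurable => // t t'; exact: hi_anti.
    by apply: measurableI => //; rewrite -[X in measurable X]setTI; exact: mh.
  have E x t : x \in `[0, thb] -> t \in `[0, 1] ->
      (level x t \in `]q, +oo[) = (hi q t < x).
    by move=> xT tI; rewrite in_itv/= andbT !ltNge level_leP.
  by apply/seteqP; split=> -[x t] [[/= xT tI]]; [rewrite E|rewrite -E].
rewrite (_ : _ `&` _ = `[0, thb] `*` `[0, 1])//.
apply/seteqP; split=> -[x t] //=; first by case.
by move=> [xT tI]; split => //; rewrite in_itv/= andbT (lt_le_trans q0)// level_ge0.
Qed.

Lemma rule_allocation : allocation thb rule.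
Proof.
have mD : measurable (`[0, thb] `*` `[0, 1] : set (R * R)) by exact: measurableX.
split; last first.
  move=> x t xT tI; rewrite /rule; case: ifP => _; last exact: level_ge0.
  by case: ifP.
have mN : measurable_fun setT (fun x : R => x \in N).
  move=> _; apply: (measurable_fun_bool true) => //; rewrite setTI.
  rewrite (_ : _ @^-1` _ = N); first exact: N_measurable.
  by apply/seteqP; split=> x; [exact: set_mem|exact: mem_set].
apply: (@measurable_fun_if _ _ _ _ _ _ _ mD (fun p : R * R => p.1 \in N)).
- by apply: measurable_funTS; exact: measurableT_comp mN _.
- have ms : measurable_fun (`[0, thb] `*` `[0, 1] : set (R * R)) (fun p => s p.1).
    apply: (@measurable_comp _ _ _ _ _ _ (`[0, thb] : set R) s
      (`[0, thb] `*` `[0, 1] : set (R * R)) fst) => //.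
    + by move=> _ [[x t] [/= xT _] <-].
    + exact: mono_on_measurable.
    + exact: measurable_funTS.
  have H : measurable_fun (`[0, thb] `*` `[0, 1] : set (R * R))
      (fun p => if p.2 <= s p.1 then 2 else 0 : R).
    apply: measurable_fun_if => //; apply: measurable_fun_ler => //.
    exact: measurable_funTS.
  by apply: measurable_funS H => // z [].
- apply: measurable_funS level_measurable => //; by move=> z [].
Qed.

(** The null set [M] absorbs the lottery types and, for strict inequalities, the boundary type of
    the pool. *)
Lemma mass_below (b : R -> bool) (M : set R) (a : R) : mu.-negligible M -> a \in `[0, thb] ->
  measurable_fun `[0, thb] (fun t => if b t then f t else 0) ->
  (forall t, t \in `[0, thb] -> ~ M t -> b t = (t <= a)) ->
  fine (\int[mu]_(t in `[0%R, thb]) (if b t then f t else 0)%:E) = F a.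
Proof.
move=> M0 aT mb bE; rewrite F_int//; congr fine.
have aT' := aT; move: aT'; rewrite in_itv/= => /andP[a0 ab].
rewrite (_ : `[0, a]%classic = `[0, thb] `&` `[0, a]); last first.
  rewrite setIC; apply/esym/setIidl; apply: subset_itvl; by rewrite bnd_simp.
rewrite integral_mkcondr; apply: ae_eq_integral => //.
- exact/measurable_EFinP.
- apply/measurable_restrict => //; apply/measurable_EFinP.
  by apply: measurable_funS f_meas => // x [].
- apply: negligibleS M0 => t /= H; apply: contrapT => Mt; apply: H => tT.
  rewrite bE// patchE; case: ifPn => ta; case: ifPn => //.
    by move=> /negP[]; rewrite inE/= in_itv/= ta andbT; move: tT; rewrite in_itv/= => /andP[].
  by rewrite inE/= in_itv/= (negbTE ta) andbF.
Qed.

Lemma N_negligible : mu.-negligible N.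
Proof.
by exists N; split => //; [exact: N_measurable|exact: countable_lebesgue_measure0].
Qed.

Lemma rule_Gchi om q : om \in `[0, 1] -> 0 <= q -> Gchi thb f rule om q = F (hi q om).
Proof.
move=> omI q0; apply: (mass_below (fun t => rule t om <= q) N) => //.
- exact: N_negligible.
- exact: hi_in.
- apply: (measurable_if_le R thb f f_meas (rule ^~ om)).
  exact: (chi_section R thb _ rule_allocation).
- by move=> t tT tN; rewrite /rule memNset// level_leP.
Qed.

Lemma rule_Gchim om q : om \in `[0, 1] -> 0 < q -> Gchim thb f rule om q = F (lo q om).
Proof.
move=> omI q0; have mr := chi_section R thb _ rule_allocation _ omI.
rewrite /Gchim /Gchi (left_limit_mass R thb f f_meas f_ge0 f_mass _ _ mr).
apply: (mass_below (fun t => rule t om < q) (N `|` [set lo q om])) => //.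
- apply: negligibleU; first exact: N_negligible.
  exists [set lo q om]; split => //; exact: lebesgue_measure_set1.
- exact: lo_in.
- exact: measurable_if_lt.
- move=> t tT /not_orP[tN tlo]; rewrite /rule memNset//.
  apply/idP/idP; first exact: level_lt_lo.
  by rewrite le_eqVlt => /predU1P[//|]; exact: lt_lo_level.
Qed.

(** At slope 2 both [lo] and [hi] are [thb], so level 2 has status 1 although only a null set of
    types can receive it. *)
Lemma rule_status x om : x \in `[0, thb] -> om \in `[0, 1] ->
  status (Gchim thb f rule om) (Gchi thb f rule om) (rule x om) =
  if x \in N then (if om <= s x then 1 else 0) else rank x om.
Proof.
move=> xT omI; rewrite /status.
have thbE z : z \in `[0, thb] -> thb <= z -> z = thb.
  by rewrite in_itv/= => /andP[_ zb] bz; apply/eqP; rewrite eq_le zb.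
have [xN|xN] := boolP (x \in N).
  have -> : rule x om = if om <= s x then 2 else 0 by rewrite /rule xN.
  have [omx|omx] := boolP (om <= s x); last by rewrite ltxx.
  have two0 : (0 : R) < 2 by [].
  rewrite two0 rule_Gchim// rule_Gchi//.
  have h2 : hi 2 om = thb.
    by apply: thbE; [exact: hi_in|rewrite -(hi1 om)// hi_mono// ler1n].
  have l2 : lo 2 om = thb.
    apply: thbE; [exact: lo_in|rewrite -(hi1 om)//].
    by apply: ismax_lt (hi_max _ _) (lo_max _ _) _; rewrite ltr1n.
  by rewrite h2 l2 Fthb; field.
have -> : rule x om = level x om by rewrite /rule (negbTE xN).
have [l0|l0] := boolP (0 < level x om).
  rewrite rule_Gchim// rule_Gchi ?level_ge0//.
  by rewrite /rank /mass_lo l0 /mass_hi.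
(* The pool of level 0 is symmetric about 0, so its rank is 0, the status of exclusion. *)
by rewrite /rank /mass_lo (negbTE l0) addNr mul0r.
Qed.

(** A type of [N] gets the top level in the states [[0, s x]], that is, with probability [s x]. *)
Lemma rule_interim x : x \in `[0, thb] -> interim thb f rule x =
  if x \in N then s x else \int[mu]_(t in `[0, 1]) rank x t.
Proof.
move=> xT; rewrite /interim.
transitivity (\int[mu]_(om in `[0, 1])
  (if x \in N then (if om <= s x then 1 else 0) else rank x om)).
  by apply: eq_Rintegral => om; rewrite inE => omI; rewrite rule_status.
case: ifPn => // xN.
have /andP[s0 s1] := s_range _ xT.
rewrite (_ : (fun om => _) = \1_(`]-oo, s x])); last first.
  apply/funext => om; rewrite indicE.
  have -> : (om \in [set` `]-oo, s x]]) = (om <= s x).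
    by apply/idP/idP; rewrite inE/= in_itv.
  by case: (om <= s x).
rewrite /Rintegral integral_indic//.
rewrite (_ : _ `&` _ = `[0, s x]%classic).
  rewrite /= lebesgue_measure_itv/= lte_fin.
  by move: s0; rewrite le_eqVlt => /predU1P[<-|->]; rewrite ?ltxx//= subr0.
apply/seteqP; split=> om /=; rewrite !in_itv/=.
  by move=> [-> /andP[->]].
by move=> /andP[-> omx]; rewrite omx (le_trans omx).
Qed.

(** Off [N] the rank is the status under [rule], which is measurable as for any allocation. *)
Lemma rank_measurable x : x \in `[0, thb] -> x \notin N ->
  measurable_fun (`[0, 1] : set R) (rank x).
Proof.
move=> xT xN.
apply: (eq_measurable_fun (fun om => status_at R thb f rule (x, om))).
  move=> om; rewrite inE => omI.
  rewrite -[LHS](status_standing R thb f f_meas f_ge0 f_mass _ rule_allocation)//.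
  by rewrite rule_status// (negbTE xN).
apply: measurable_funTS; apply: measurable_fun_pair2.
by apply: status_at_meas => //; exact: rule_allocation.
Qed.

End Mechanism.

(** * Two subgradients of the same function *)

Lemma subgrad_lt (g h : R -> R) :
  (forall x y, x \in `[0, thb] -> y \in `[0, thb] -> g x * (F y - F x) <= K y - K x) ->
  (forall x y, x \in `[0, thb] -> y \in `[0, thb] -> h x * (F y - F x) <= K y - K x) ->
  forall x y, x \in `[0, thb] -> y \in `[0, thb] -> x < y -> g x <= h y.
Proof.
move=> gK hK x y xT yT xy; have Fxy := F_incr _ _ xT yT xy.
have := gK _ _ xT yT; have := hK _ _ yT xT => h1 h2.
rewrite -(@ler_pM2r _ (F y - F x)); lra.
Qed.

(** Choose a rational strictly between the two values wherever they differ. By [subgrad_lt] the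
    intervals at distinct types are disjoint, so the choice is injective. *)
Lemma subgrad_countable_diff (g h : R -> R) :
  (forall x y, x \in `[0, thb] -> y \in `[0, thb] -> g x * (F y - F x) <= K y - K x) ->
  (forall x y, x \in `[0, thb] -> y \in `[0, thb] -> h x * (F y - F x) <= K y - K x) ->
  countable [set x | x \in `[0, thb] /\ g x <> h x].
Proof.
move=> gK hK.
have pick x : exists q : rat, x \in `[0, thb] /\ g x <> h x ->
    Num.min (g x) (h x) < ratr q < Num.max (g x) (h x).
  have [gh|/eqP gh] := eqVneq (g x) (h x); first by exists 0 => -[].
  have /rat_in_itvoo[q qI] : Num.min (g x) (h x) < Num.max (g x) (h x).
    by rewrite gt_min !lt_max !ltxx/= orbF -neq_lt; exact/eqP.
  by exists q => _; move: qI; rewrite in_itv.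
have [r rP] := choice pick.
apply/countable_injP; exists (fun x => pickle (r x)) => x y.
rewrite !inE => xN yN /(pcan_inj pickleK) rE.
have lt_inj a b : a \in `[0, thb] /\ g a <> h a -> b \in `[0, thb] /\ g b <> h b ->
    r a = r b -> ~ a < b.
  move=> aN bN rab ab.
  have /andP[_ ra] := rP a aN; have /andP[rb _] := rP b bN; rewrite rab in ra.
  have := lt_trans rb ra; apply/negP; rewrite -leNgt.
  have [[aT _] [bT _]] := (aN, bN).
  rewrite ge_max !le_min.
  by rewrite !(subgrad_lt _ _ _ _ a b).
have [yx|xy|//] := ltgtP y x; first by case: (lt_inj _ _ yN xN (esym rE) yx).
by case: (lt_inj _ _ xN yN rE xy).
Qed.

Lemma feasible_of_envelope (f : R -> R) :
  measurable_fun `[0, thb] f -> (forall t, t \in `[0, thb] -> 0 <= f t) ->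
  (\int[mu]_(t in `[0%R, thb]) (f t)%:E = 1)%E ->
  (forall x, x \in `[0, thb] -> F x = \int[mu]_(t in `[0, x]) f t) ->
  (forall x y, x \in `[0, thb] -> y \in `[0, thb] -> x <= y -> s x <= s y) ->
  feasible thb f s.
Proof.
move=> mf f0 f1 Ff sm.
pose phi x := \int[mu]_(t in `[0, 1]) rank x t.
have phiK x y : x \in `[0, thb] -> y \in `[0, thb] -> phi x * (F y - F x) <= K y - K x.
  move=> xT yT; apply: rank_integral_subgrad => //.
  (* With an empty lottery set, measurability holds at every type; the actual [N] can only be chosen
     once [phi] is available. *)
  by apply: (rank_measurable f set0) => //; rewrite in_set0.
pose N := [set x | x \in `[0, thb] /\ s x <> phi x].
have cN : countable N by exact: subgrad_countable_diff.
exists (rule N); split; first exact: rule_allocation.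
move=> x xT; rewrite (rule_interim f N)//; case: ifPn => // /negP xN.
by apply: contrapT => sp; apply: xN; rewrite inE.
Qed.

End Envelope.

(** * The distribution function *)

Section Cdf.
Variables (R : realType) (thb : R) (f : R -> R).
Local Notation mu := (@lebesgue_measure R).
Hypothesis thb_gt0 : 0 < thb.
Hypothesis f_cont : {within `[0, thb], continuous f}.
Hypothesis f_pos : forall t, t \in `[0, thb] -> 0 < f t.
Hypothesis F_cdf : (\int[mu]_(t in `[0%R, thb]) (f t)%:E = 1)%E.

(** Composition with [clamp] extends [F] and [K] continuously to the whole line, as the envelope
    construction requires. *)
Definition clamp (x : R) : R := Num.max 0 (Num.min thb x).

Lemma clamp_in x : clamp x \in `[0, thb].
Proof.
by rewrite in_itv/= /clamp le_max lexx/= ge_max (ltW thb_gt0)/= ge_min lexx.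
Qed.

Lemma clamp_id x : x \in `[0, thb] -> clamp x = x.
Proof. by rewrite in_itv/= => /andP[x0 xb]; rewrite /clamp (min_r xb) (max_r x0). Qed.

Lemma clamp_lip x y : x <= y -> clamp x <= clamp y /\ clamp y - clamp x <= y - x.
Proof.
move=> xy; rewrite /clamp; have := thb_gt0; rewrite /Num.max /Num.min.
by do ![case: ifPn]; rewrite -?leNgt => *; split; lra.
Qed.

Lemma lipschitz_clamp_continuous (g : R -> R) (M : R) :
  (forall x y, x \in `[0, thb] -> y \in `[0, thb] -> x <= y ->
     `|g y - g x| <= M * (y - x)) -> continuous (g \o clamp).
Proof.
move=> gM x; apply/cvgrPdist_lt => /= e e0.
pose C := `|M| + 1.
have C0 : 0 < C by rewrite /C ltr_pwDr.
have lip a b : a <= b -> `|g (clamp b) - g (clamp a)| <= C * (b - a).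
  move=> ab; have [c1 c2] := clamp_lip _ _ ab.
  apply: le_trans (gM _ _ (clamp_in _) (clamp_in _) c1) _.
  apply: (@le_trans _ _ (C * (clamp b - clamp a))).
    by rewrite ler_wpM2r ?subr_ge0// /C (le_trans (ler_norm _))// lerDl.
  by rewrite ler_wpM2l// ltW.
near=> z.
have xz : `|x - z| < e / C.
  by near: z; apply: (@cvgr_dist_lt _ _ _ _ _ (fun z : R => z) x) => //; rewrite divr_gt0.
rewrite ltr_pdivlMr// mulrC in xz; apply: le_lt_trans xz.
have [zx|/ltW xz] := leP z x.
  have -> : `|x - z| = x - z by rewrite ger0_norm// subr_ge0.
  exact: lip.
rewrite distrC; have -> : `|x - z| = z - x by rewrite distrC ger0_norm// subr_ge0.
exact: lip.
Unshelve. all: by end_near. Qed.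

Lemma f_measurable : measurable_fun `[0, thb] f.
Proof. exact: subspace_continuous_measurable_fun. Qed.

Lemma f_bounded : exists2 M, 0 <= M & forall t, t \in `[0, thb] -> 0 <= f t <= M.
Proof.
have [c cT cmax] := EVT_max (ltW thb_gt0) f_cont.
exists (f c); first by rewrite ltW// f_pos.
by move=> t tT; rewrite cmax// ltW// f_pos.
Qed.

Lemma subitv x y : x \in `[0, thb] -> y \in `[0, thb] -> `[x, y] `<=` `[0, thb].
Proof.
rewrite !in_itv/= => /andP[x0 _] /andP[_ yb].
by apply: subset_itv; rewrite bnd_simp.
Qed.

Lemma fI : mu.-integrable `[0, thb] (EFin \o f).
Proof.
by apply: f_integrable => //; [exact: f_measurable|move=> t tT; rewrite ltW// f_pos].
Qed.

Lemma cdfB x y : x \in `[0, thb] -> y \in `[0, thb] -> x <= y ->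
  cdfF f y - cdfF f x = \int[mu]_(t in `[x, y]) f t.
Proof.
move=> xT yT xy; apply: (integral_split R 0 thb) => //; first exact: fI.
  by move: xT; rewrite in_itv/= => /andP[].
by move: yT; rewrite in_itv/= => /andP[].
Qed.

Lemma cdf0 : cdfF f 0 = 0.
Proof. by rewrite /cdfF set_itv1 integral_set1. Qed.

Lemma cdf1 : cdfF f thb = 1.
Proof. by rewrite /cdfF F_cdf. Qed.

Lemma integral_lip (g : R -> R) (M x y : R) :
  measurable_fun `[0, thb] g -> (forall t, t \in `[0, thb] -> 0 <= g t <= M) ->
  x \in `[0, thb] -> y \in `[0, thb] -> x <= y ->
  0 <= \int[mu]_(t in `[x, y]) g t <= M * (y - x).
Proof.
move=> mg gM xT yT xy; have sub := subitv _ _ xT yT.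
apply/andP; split.
  by apply: Rintegral_ge0 => t /sub/gM/andP[].
have -> : M * (y - x) = \int[mu]_(t in `[x, y]) M.
  rewrite Rintegral_cst//= lebesgue_measure_itv/= lte_fin.
  by move: xy; rewrite le_eqVlt => /predU1P[->|->]; rewrite ?ltxx ?subrr.
apply: le_Rintegral => //.
- apply: (bounded_itv_integrable _ _ _ M); first exact: measurable_funS mg.
  by move=> t /sub/gM/andP[? ?]; rewrite ger0_norm.
- by apply: (bounded_itv_integrable _ _ _ `|M|).
- by move=> t /sub/gM/andP[].
Qed.

(** On [[x, y]] the density attains a positive minimum. *)
Lemma cdf_incr x y : x \in `[0, thb] -> y \in `[0, thb] -> x < y -> cdfF f x < cdfF f y.
Proof.
move=> xT yT xy; rewrite -subr_gt0 cdfB ?ltW//.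
have sub := subitv _ _ xT yT.
have cxy : {within `[x, y], continuous f}.
  exact: continuous_subspaceW f_cont.
have [c cT cmin] := EVT_min (ltW xy) cxy.
have fc : 0 < f c by apply: f_pos; exact: sub.
apply: (@lt_le_trans _ _ (f c * (y - x))); first by rewrite mulr_gt0 ?subr_gt0.
have -> : f c * (y - x) = \int[mu]_(t in `[x, y]) f c.
  by rewrite Rintegral_cst//= lebesgue_measure_itv/= lte_fin xy.
apply: le_Rintegral => //.
- by apply: (bounded_itv_integrable _ _ _ `|f c|).
- exact: integrableS fI.
Qed.

(** [F] is the [F]-subgradient of [F^2/2], so [subgrad_integral] applies with weight [f]. *)
Lemma cdf_integral x : x \in `[0, thb] ->
  \int[mu]_(t in `[x, thb]) (cdfF f t * f t) = (1 - cdfF f x ^+ 2) / 2.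
Proof.
move=> xT; have [M M0 fM] := f_bounded.
have sub := subitv _ _ xT (thb_in R thb (ltW thb_gt0)).
have cdf_le u v : u \in `[0, thb] -> v \in `[0, thb] -> u <= v -> cdfF f u <= cdfF f v.
  move=> uT vT; rewrite le_eqVlt => /predU1P[->//|uv]; by rewrite ltW// cdf_incr.
rewrite (subgrad_integral R x thb M (cdfF f) f (fun z => cdfF f z ^+ 2 / 2)).
- by rewrite cdf1; lra.
- by move: xT; rewrite in_itv/= => /andP[].
- by move=> u v /sub uT /sub vT; exact: cdf_le.
- exact: measurable_funS f_measurable.
- by move=> u /sub; exact: fM.
- move=> u v /sub uT /sub vT uv; rewrite -cdfB//.
  have := cdf_le _ _ uT vT uv; move: (cdfF f u) (cdfF f v) => a b ab.
  apply/andP; split; nra.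
Qed.

End Cdf.

(** * Both directions of the characterization *)

Theorem theorem1 (R : realType) (thb : R) (f : R -> R)
  (thb_gt0 : 0 < thb)
  (f_cont : {within `[0, thb], continuous f})
  (f_pos : forall t, t \in `[0, thb] -> 0 < f t)
  (F_cdf : (\int[@lebesgue_measure R]_(t in `[0%R, thb]) (f t)%:E = 1)%E)
  (s : R -> R)
  (s_range : forall th, th \in `[0, thb] -> 0 <= s th <= 1)
  (s_mono : forall a b, a \in `[0, thb] -> b \in `[0, thb] -> a <= b -> s a <= s b) :
  feasible thb f s <->
  (forall x, x \in `[0, thb] ->
     (\int[@lebesgue_measure R]_(t in `[x, thb]) (s t * f t)%:E
      <= \int[@lebesgue_measure R]_(t in `[x, thb]) (cdfF f t * f t)%:E)%E).
Proof.
have mf : measurable_fun `[0, thb] f by exact: f_measurable.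
have f_ge0 t : t \in `[0, thb] -> 0 <= f t by move=> tT; rewrite ltW// f_pos.
have [M M0 fM] := f_bounded R thb f thb_gt0 f_cont f_pos.
have zT : 0 \in `[0, thb] by apply: zero_in; exact: ltW.
have bT : thb \in `[0, thb] by apply: thb_in; exact: ltW.
have F0 : cdfF f 0 = 0 by exact: cdf0.
have F1 : cdfF f thb = 1 by exact: cdf1.
have F_incr x y : x \in `[0, thb] -> y \in `[0, thb] -> x < y -> cdfF f x < cdfF f y.
  exact: cdf_incr.
have F_le x y : x \in `[0, thb] -> y \in `[0, thb] -> x <= y -> cdfF f x <= cdfF f y.
  by move=> xT yT; rewrite le_eqVlt => /predU1P[->//|xy]; rewrite ltW// F_incr.
have FB x y : x \in `[0, thb] -> y \in `[0, thb] -> x <= y ->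
    cdfF f y - cdfF f x = \int[@lebesgue_measure R]_(t in `[x, y]) f t.
  exact: cdfB.
have ms : measurable_fun `[0, thb] s by exact: mono_on_measurable.
have weighted (g : R -> R) : measurable_fun `[0, thb] g ->
    (forall t, t \in `[0, thb] -> 0 <= g t <= 1) ->
    (@lebesgue_measure R).-integrable `[0, thb] (EFin \o (fun t => g t * f t)).
  move=> mg g01; apply: (bounded_itv_integrable R 0 thb M).
    exact: measurable_funM.
  move=> t tT; have /andP[g0 g1] := g01 _ tT; have /andP[f0 f1] := fM _ tT.
  by rewrite ger0_norm ?mulr_ge0// -[leRHS]mul1r ler_pM.
have FfE x : x \in `[0, thb] ->
    (\int[@lebesgue_measure R]_(t in `[x, thb]) (cdfF f t * f t)%:E =
     ((1 - cdfF f x ^+ 2) / 2)%:E)%E.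
  move=> xT; rewrite -(cdf_integral R thb f)// /Rintegral fineK//.
  apply: integrable_fin_num => //; apply: integrableS (weighted (cdfF f) _ _) => //.
  - exact: subitv.
  - exact: mono_on_measurable.
  - move=> t tT; rewrite -F0 -F1; have := tT; rewrite in_itv/= => /andP[t0 tb].
    by rewrite !F_le.
have sfE x : x \in `[0, thb] -> (\int[@lebesgue_measure R]_(t in `[x, thb]) (s t * f t)%:E =
    (\int[@lebesgue_measure R]_(t in `[x, thb]) (s t * f t))%:E)%E.
  move=> xT; rewrite /Rintegral fineK//.
  apply: integrable_fin_num => //; apply: integrableS (weighted s ms s_range) => //.
  exact: subitv.
split=> [[chi [chi_alloc sE]] x xT|H].
  rewrite FfE//; have := xT; rewrite in_itv/= => /andP[x0 xb].
  (* For [m = 1 - F x] the bound [m - m^2/2] is [(1 - F x ^2) / 2], the right-hand side. *)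
  apply: le_trans (interim_mass_le R thb f mf f_ge0 F_cdf chi chi_alloc s x
    (1 - cdfF f x) xT ms _ sE _) _.
  - by move=> th /s_range/andP[].
  - by rewrite -F1 FB.
  - by rewrite lee_fin; lra.
pose I x := \int[@lebesgue_measure R]_(t in `[0, x]) (s t * f t).
have IB x y : x \in `[0, thb] -> y \in `[0, thb] -> x <= y ->
    I y - I x = \int[@lebesgue_measure R]_(t in `[x, y]) (s t * f t).
  move=> xT yT xy; apply: (integral_split R 0 thb) => //; first exact: weighted.
    by move: xT; rewrite in_itv/= => /andP[].
  by move: yT; rewrite in_itv/= => /andP[].
(* The constant makes [K thb = 1/2], the value of [F^2/2] at [thb]. *)
pose K x := 1 / 2 - I thb + I x.
(* Increments of [K] are integrals of [s dF], so monotonicity makes [s] an [F]-subgradient of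
   [K]. *)
have s_bounds x y : x \in `[0, thb] -> y \in `[0, thb] -> x <= y ->
    s x * (cdfF f y - cdfF f x) <= K y - K x <= s y * (cdfF f y - cdfF f x).
  move=> xT yT xy; rewrite FB// (_ : K y - K x = I y - I x); last by rewrite /K; ring.
  rewrite IB//; have sub := subitv _ _ _ _ xT yT.
  apply: (mono_weight_bounds R x y M) => //.
  - by move=> u v /sub uT /sub vT; exact: s_mono.
  - exact: measurable_funS mf.
  - by move=> u /sub; exact: fM.
have sf_bounds t : t \in `[0, thb] -> 0 <= s t * f t <= M.
  move=> tT; have /andP[s0 s1] := s_range _ tT; have /andP[f0 f1] := fM _ tT.
  by rewrite mulr_ge0//= -[leRHS]mul1r ler_pM.
have lip (g h : R -> R) : measurable_fun `[0, thb] g ->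
    (forall t, t \in `[0, thb] -> 0 <= g t <= M) ->
    (forall x y, x \in `[0, thb] -> y \in `[0, thb] -> x <= y ->
       h y - h x = \int[@lebesgue_measure R]_(t in `[x, y]) g t) ->
    continuous (h \o clamp R thb).
  move=> mg gM hB; apply: (lipschitz_clamp_continuous R thb thb_gt0 h M) => x y xT yT xy.
  rewrite hB//; have /andP[i0 iM] := integral_lip R thb g M x y mg gM xT yT xy.
  by rewrite ger0_norm.
have cid x : x \in `[0, thb] -> clamp R thb x = x by exact: clamp_id.
apply: (feasible_of_envelope R thb (cdfF f \o clamp R thb) (K \o clamp R thb) s) => //=.
- exact: ltW.
- exact: (lip f).
- apply: (lip (fun t => s t * f t)) => //; first exact: measurable_funM.
  by move=> x y xT yT xy; rewrite -IB// /K; ring.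
- by rewrite cid.
- by rewrite cid.
- by move=> x y xT yT xy; rewrite !cid// F_incr.
- move=> x y xT yT; rewrite !cid//; have [xy|/ltW yx] := leP x y.
    by have /andP[] := s_bounds _ _ xT yT xy.
  by have /andP[_] := s_bounds _ _ yT xT yx; lra.
(* At [x] the majorization inequality reads [F x ^2 / 2 <= K x]. *)
- move=> x xT; rewrite cid//; have := H x xT; rewrite FfE// sfE// lee_fin.
  have := xT; rewrite in_itv/= => /andP[_ xb].
  by rewrite -IB// /K; lra.
- by rewrite cid// /K; ring.
- by move=> x xT; rewrite cid.
Qed.
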